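(* Let $I,J$ be finite sets, and let $(A_i)_{i\in I}$, $(B_j)_{j\in J}$ be families of finite sets. Let $\mathcal{H}$ be a Hilbert space, and let $\{X_{i,\alpha}\}_{i\in I,\alpha\in A_i}\subset\mathcal{B}(\mathcal{H})$ and $\{Y_{j,\beta}\}_{j\in J,\beta\in B_j}\subset\mathcal{B}(\mathcal{H})$ be positive operators with $\sum_{\alpha\in A_i}X_{i,\alpha}=\mathbb{1}$ for every $i\in I$, $\sum_{\beta\in B_j}Y_{j,\beta}=\mathbb{1}$ for every $j\in J$, and $[X_{i,\alpha},Y_{j,\beta}]=0$ for all $i,j,\alpha,\beta$. Let $\omega$ be a state on $\mathcal{B}(\mathcal{H})$ and put $$p(i,j\,|\,\alpha,\beta)=\omega(X_{i,\alpha}\cdot Y_{j,\beta})\qquad (i\in I,\ j\in J,\ \alpha\in A_i,\ \beta\in B_j).$$ Then the following are equivalent. (i) The correlation function $p$ is approximately finite dimensional. (ii) There exist Hilbert spaces $\mathcal{H}_A$, $\mathcal{H}_B$, positive operators $\{\tilde X_{i,\alpha}\}_{i\in I,\alpha\in A_i}\subset\mathcal{B}(\mathcal{H}_A)$ with $\sum_{\alpha\in A_i}\tilde X_{i,\alpha}=\mathbb{1}$ for every $i\in I$, positive operators $\{\tilde Y_{j,\beta}\}_{j\in J,\beta\in B_j}\subset\mathcal{B}(\mathcal{H}_B)$ with $\sum_{\beta\in B_j}\tilde Y_{j,\beta}=\mathbb{1}$ for every $j\in J$, and a state $\tilde\omega$ on $\mathcal{B}(\mathcal{H}_A\otimes\mathcal{H}_B)$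 such that $$p(i,j\,|\,\alpha,\beta)=\tilde\omega(\tilde X_{i,\alpha}\otimes\tilde Y_{j,\beta})$$ for all $i,j,\alpha,\beta$.
   Context: Hilbert spaces are complex and may be infinite dimensional; $\mathcal{B}(\mathcal{H})$ is the algebra of all bounded operators on $\mathcal{H}$, and $\mathcal{H}_A\otimes\mathcal{H}_B$ is the Hilbert space tensor product. A state on $\mathcal{B}(\mathcal{H})$ is a positive linear functional $\omega$ on $\mathcal{B}(\mathcal{H})$ with $\omega(\mathbb{1})=1$ (no normality is required). Definition (approximately finite dimensional). A correlation function $p$, assigning a number $p(i,j\,|\,\alpha,\beta)\in[0,1]$ to each $i\in I$, $j\in J$, $\alpha\in A_i$, $\beta\in B_j$, is called approximately finite dimensional if for every $\varepsilon>0$ there exist a finite-dimensional Hilbert space $\mathcal{H}_\varepsilon$, positive operators $\{X^{\varepsilon}_{i,\alpha}\}_{i\in I,\alpha\in A_i}$ and $\{Y^{\varepsilon}_{j,\beta}\}_{j\in J,\beta\in B_j}$ in $\mathcal{B}(\mathcal{H}_\varepsilon)$ with $\sum_{\alpha\in A_i}X^{\varepsilon}_{i,\alpha}=\mathbb{1}$ for every $i$, $\sum_{\beta\in B_j}Y^{\varepsilon}_{j,\beta}=\mathbb{1}$ for every $j$, and $[X^{\varepsilon}_{i,\alpha},Y^{\varepsilon}_{j,\beta}]=0$ for all $i,j,\alpha,\beta$, and a state $\omega_\varepsilon$ on $\mathcal{B}(\mathcal{H}_\varepsilon)$ such that $$|p(i,j\,|\,\alpha,\beta)-\omega_\varepsilon(X^{\varepsilon}_{i,\alpha}\cdot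 Y^{\varepsilon}_{j,\beta})|<\varepsilon$$ for all $i,j,\alpha,\beta$. *)

(* Defs.v *)
From HB Require Import structures.
From mathcomp Require Import all_boot all_order all_algebra.
From mathcomp Require Import sesquilinear complex.
From mathcomp Require Import boolp classical_sets functions reals.
From mathcomp Require Import topology normedtype.

Set Implicit Arguments.
Unset Strict Implicit.
Unset Printing Implicit Defensive.

Import Order.TTheory GRing.Theory Num.Theory.
Import numFieldNormedType.Exports.

Local Open Scope ring_scope.
Local Open Scope complex_scope.
Local Open Scope classical_set_scope.

(* [hdot] is linear in its first argument and conjugate-linear in the second;
   the norm of a normed module over [R[i]] is itself [R[i]]-valued. *)
HB.mixin Record CompleteNormedModule_isHilbert (R : realType) (V : Type)
    & CompleteNormedModule R[i] V := {
  hdot : {dot V for @Num.conj R[i]};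
  hdotxx : forall x : V, hdot x x = `|x| ^+ 2
}.

#[short(type="hilbertType")]
HB.structure Definition Hilbert (R : realType) :=
  {V of CompleteNormedModule R[i] V & CompleteNormedModule_isHilbert R V}.

Section BoundedOperators.
Context {R : realType} (H : hilbertType R).

Definition bounded_op : pred (H -> H) := fun f =>
  `[< linear f /\ exists M : R, forall x, `|f x| <= M%:C * `|x| >].

Lemma bounded_opP (f : H -> H) : reflect
  (linear f /\ exists M : R, forall x, `|f x| <= M%:C * `|x|)
  (f \in bounded_op).
Proof. exact: asboolP. Qed.

Lemma bounded_op_ge0 (f : H -> H) : f \in bounded_op ->
  exists2 M : R, 0 <= M & forall x, `|f x| <= M%:C * `|x|.
Proof.
move=> /bounded_opP[_ [M fM]]; exists `|M| => // x.
by apply: le_trans (fM x) _; rewrite ler_wpM2r// lecR ler_norm.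
Qed.

Lemma bounded_op_submod : submod_closed bounded_op.
Proof.
split=> [|a f g].
  apply/bounded_opP; split=> [b x y|]; first by rewrite /= scaler0 addr0.
  by exists 0 => x; rewrite normr0 mul0r.
move=> Bf Bg; have [/bounded_opP[lf _] /bounded_opP[lg _]] := (Bf, Bg).
have [M M0 fM] := bounded_op_ge0 Bf; have [N N0 gN] := bounded_op_ge0 Bg.
apply/bounded_opP; split=> [b x y|].
  change (a *: f (b *: x + y) + g (b *: x + y) =
          b *: (a *: f x + g x) + (a *: f y + g y)).
  by rewrite lf lg !scalerDr !scalerA (mulrC a) addrACA.
exists (complex.Re `|a| * M + N) => x.
change (`|a *: f x + g x| <= (complex.Re `|a| * M + N)%:C * `|x|).
apply: le_trans (ler_normD _ _) _.
have aE : (complex.Re `|a|)%:C = `|a| by rewrite RRe_real ?normr_real.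
rewrite normrZ rmorphD rmorphM -[in leLHS]aE mulrDl.
by rewrite lerD// -mulrA ler_wpM2l ?aE //; exact: fM.
Qed.

HB.instance Definition _ :=
  GRing.isSubmodClosed.Build R[i] (H -> H) bounded_op bounded_op_submod.

Record bop := BOp { bop_fun :> H -> H; bop_bounded : bop_fun \in bounded_op }.

HB.instance Definition _ := [isSub for bop_fun].
HB.instance Definition _ := [Choice of bop by <:].
HB.instance Definition _ := [SubChoice_isSubLmodule of bop by <:].

Lemma bop_linear (T : bop) : linear T.
Proof. by have /bounded_opP[] := bop_bounded T. Qed.

HB.instance Definition _ (T : bop) :=
  GRing.isLinear.Build R[i] H H _ (bop_fun T) (bop_linear T).

Lemma bopP (S T : bop) : S =1 T -> S = T.
Proof. by move=> ST; apply/val_inj/funext. Qed.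

Fact bop_one_subproof : idfun \in bounded_op.
Proof. by apply/bounded_opP; split=> //; exists 1 => x; rewrite mul1r. Qed.
Definition bop_one : bop := BOp bop_one_subproof.

Fact bop_mul_subproof (S T : bop) : S \o T \in bounded_op.
Proof.
have [M M0 SM] := bounded_op_ge0 (bop_bounded S).
have [N N0 TN] := bounded_op_ge0 (bop_bounded T).
apply/bounded_opP; split=> [a x y|]; first by rewrite /= !linearP.
exists (M * N) => x /=; apply: le_trans (SM _) _.
by rewrite rmorphM /= -mulrA ler_wpM2l// ler0c.
Qed.
Definition bop_mul (S T : bop) : bop := BOp (bop_mul_subproof S T).

Fact bop_mulA : associative bop_mul. Proof. by move=> ? ? ?; exact: bopP. Qed.
Fact bop_mul1 : left_id bop_one bop_mul. Proof. by move=> ?; exact: bopP. Qed.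
Fact bop_mulr1 : right_id bop_one bop_mul. Proof. by move=> ?; exact: bopP. Qed.
Fact bop_mulDl : left_distributive bop_mul +%R.
Proof. by move=> ? ? ?; exact: bopP. Qed.
Fact bop_mulDr : right_distributive bop_mul +%R.
Proof. by move=> S T U; apply: bopP => x; exact: linearD. Qed.

(* Not an [nzRingType]: the operators on the zero space form the zero ring. *)
HB.instance Definition _ := GRing.Zmodule_isPzRing.Build bop
  bop_mulA bop_mul1 bop_mulr1 bop_mulDl bop_mulDr.

Lemma bop1E x : (1 : bop) x = x. Proof. by []. Qed.
Lemma bopME (S T : bop) x : (S * T) x = S (T x). Proof. by []. Qed.
Lemma bopDE (S T : bop) x : (S + T) x = S x + T x. Proof. by []. Qed.
Lemma bopZE a (T : bop) x : (a *: T) x = a *: T x. Proof. by []. Qed.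

(* On R[i], [0 <= z] says that z is real and nonnegative. *)
Definition positive_op (T : bop) := forall x : H, 0 <= hdot (T x) x.

Definition is_state (w : {scalar bop}) :=
  w 1 = 1 /\ forall T : bop, positive_op T -> 0 <= w T.

Definition finite_dimensional :=
  exists n (e : 'I_n -> H), forall x, exists c : 'I_n -> R[i],
    x = \sum_(k < n) c k *: e k.

Lemma bop_continuous (T : bop) : continuous T.
Proof.
have [M M0 TM] := bounded_op_ge0 (bop_bounded T).
apply: (@bounded_linear_continuous _ _ _ (T : {linear H -> H})).
apply/linear_boundedP; near=> r => x; apply: le_trans (TM x) _.
rewrite ler_wpM2r//; near: r; apply: nbhs_pinfty_ge.
by rewrite ger0_real// ler0c.
Unshelve. all: by end_near. Qed.

End BoundedOperators.

Notation "''B' ( H )" := (bop H) (format "''B' ( H )") : type_scope.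

Section Correlations.
Context {R : realType} {I J : finType} {A : I -> finType} {B : J -> finType}.

Definition povm_family {K : finType} {C : K -> finType} {H : hilbertType R}
    (X : forall k, C k -> 'B(H)) :=
  (forall k a, positive_op (X k a)) /\ (forall k, \sum_(a : C k) X k a = 1).

Definition correlation {H : hilbertType R} (w : {scalar 'B(H)})
    (X : forall i, A i -> 'B(H)) (Y : forall j, B j -> 'B(H)) :
    forall i j, A i -> B j -> R[i] :=
  fun i j a b => w (X i a * Y j b).

Definition approx_finite_dimensional (p : forall i j, A i -> B j -> R[i]) :=
  (forall i j a b, 0 <= p i j a b <= 1) /\
  forall e : R, 0 < e ->
  exists (H : hilbertType R) (X : forall i, A i -> 'B(H))
         (Y : forall j, B j -> 'B(H)) (w : {scalar 'B(H)}),
    [/\ finite_dimensional H, povm_family X /\ povm_family Y,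
        forall i j a b, X i a * Y j b = Y j b * X i a,
        is_state w &
        forall i j a b, `|p i j a b - w (X i a * Y j b)| < e%:C].

End Correlations.

Section HilbertTensor.
Context {R : realType} {HA HB K : hilbertType R}.

(* The pair (K, t) is a realization of the Hilbert space tensor product of HA
   and HB, with [t x y] in the role of the elementary tensor of x and y; such a
   pair is unique up to a unique unitary that intertwines the maps t. *)
Definition hilbert_tensor (t : {bilinear HA -> HB -> K}) :=
  (forall x x' y y', hdot (t x y) (t x' y') = hdot x x' * hdot y y') /\
  closure [set z : K | exists n (x : 'I_n -> HA) (y : 'I_n -> HB),
                         z = \sum_(k < n) t (x k) (y k)] = setT.

(* T is the tensor product of the operators X and Y: when [hilbert_tensor t]
   holds, such a bounded T always exists, and it is unique by
   [tensor_op_unique] below. *)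
Definition tensor_op (t : {bilinear HA -> HB -> K})
    (X : 'B(HA)) (Y : 'B(HB)) (T : 'B(K)) :=
  forall x y, T (t x y) = t (X x) (Y y).

Lemma tensor_op_unique (t : {bilinear HA -> HB -> K}) X Y (S T : 'B(K)) :
  hilbert_tensor t -> tensor_op t X Y S -> tensor_op t X Y T -> S = T.
Proof.
move=> [_ dense] SE TE; apply: bopP => z; apply/eqP; rewrite -subr_eq0; apply/eqP.
have cl : closed [set z | (S - T) z = 0].
  apply: (@preimage_closed _ _ (S - T) [set 0]) => [u _|]; first exact: bop_continuous.
  apply: accessible_closed_set1; apply: hausdorff_accessible.
  exact: norm_hausdorff.
suff : closure [set z : K | exists n (x : 'I_n -> HA) (y : 'I_n -> HB),
    z = \sum_(k < n) t (x k) (y k)] `<=` [set z | (S - T) z = 0].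
  by rewrite dense => /(_ z I).
rewrite [X in _ `<=` X]((closure_id _).1 cl); apply: closureS.
move=> _ [n [x [y ->]]]; rewrite /mkset linear_sum big1// => k _.
by change (S (t (x k) (y k)) - T (t (x k) (y k)) = 0); rewrite SE TE subrr.
Qed.

End HilbertTensor.

(* Main.v *)
(* Both conditions are equivalent to a third one: for every e > 0, p is e-close
   to a correlation \sum_z <(M (x) N) z, z>, where M and N run over matrix POVMs
   and the finitely many vectors z satisfy \sum_z |z|^2 = 1.

   Commuting operators on C^d: let T = \sum c (M (x) N) + s and
   S = \sum c M N + s.  The linear map that sends M (x) N to M N carries the
   powers of T to those of S, so the characteristic polynomial of T annihilates
   S, and T >= 0 implies S >= 0.  By convex separation in a finite-dimensional
   real space, the values w(M N) of a state w are then limits of values of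
   convex combinations of vector states at the operators M (x) N.

   From the third condition one gets the tensor product model by taking the l2
   direct sums of the matrix models for e = 1/n, and as state the limit along an
   ultrafilter of the vector states carried by the n-th blocks.

   Conversely, in a tensor product model the same separation argument reduces
   an arbitrary, possibly non-normal state to vector states of algebraic
   tensors; finitely many of these lie in the tensor product of two
   finite-dimensional subspaces, to which the POVMs are compressed. *)

Require Import Defs.
From HB Require Import structures.
From mathcomp Require Import all_boot all_order all_algebra.
From mathcomp Require Import sesquilinear complex spectral mxtens.
From mathcomp Require Import boolp classical_sets functions reals interval_inference.
From mathcomp Require Import topology normedtype.
From mathcomp Require Import ring lra.

Set Implicit Arguments.
Unset Strict Implicit.
Unset Printing Implicit Defensive.

Import Order.TTheory GRing.Theory Num.Theory.
Import numFieldNormedType.Exports.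

Local Open Scope ring_scope.
Local Open Scope complex_scope.

(** * Limits along filters *)

Section FilterLimit.
Local Open Scope classical_set_scope.
Context {R : realType}.
Implicit Types (e r : R).

Lemma normc_Re_le (z : R[i]) : (`|complex.Re z|%:C <= `|z|).
Proof. by case: z => a b; rewrite normc_def lecR /= -sqrtr_sqr ler_wsqrtr// lerDl sqr_ge0. Qed.

Lemma normc_Im_le (z : R[i]) : (`|complex.Im z|%:C <= `|z|).
Proof. by case: z => a b; rewrite normc_def lecR /= -sqrtr_sqr ler_wsqrtr// lerDr sqr_ge0. Qed.

Lemma normc_le_ReIm (z : R[i]) : `|z| <= (`|complex.Re z| + `|complex.Im z|)%:C.
Proof.
have -> : z = (complex.Re z)%:C + 'i%C * (complex.Im z)%:C by exact: complexE.
apply: le_trans (ler_normD _ _) _; rewrite normrM.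
have -> : `|'i%C : R[i]| = 1 by rewrite normc_def /= expr0n add0r expr1n sqrtr1.
by rewrite mul1r rmorphD /= !normc_def /= !expr0n /= !mul0r !mul1r ?addr0 ?add0r ?subr0 !sqrtr_sqr.
Qed.

Lemma norm_complexE (z : R[i]) : exists2 r : R, 0 <= r & `|z| = r%:C.
Proof.
exists (complex.Re `|z|); last by rewrite RRe_real ?normr_real.
by rewrite -ler0c RRe_real ?normr_real.
Qed.

Lemma small_eq0 (z : R[i]) : (forall e, 0 < e -> `|z| <= e%:C) -> z = 0.
Proof.
move=> ze; apply/eqP; rewrite -normr_eq0; apply/eqP.
have [r r0 zr] := norm_complexE z.
rewrite zr; apply: congr1; apply/eqP; rewrite eq_le r0 andbT.
by apply/ler_addgt0Pl => e e0; rewrite addr0 -lecR -zr ze.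
Qed.

Lemma near_ge0 (z : R[i]) :
  (forall e, 0 < e -> exists2 w, 0 <= w & `|w - z| <= e%:C) -> 0 <= z.
Proof.
move=> zP; rewrite lecE /=; apply/andP; split.
  rewrite -normr_le0; apply/ler_addgt0Pl => e /zP[w w0 wz]; rewrite addr0.
  rewrite -lecR; apply: le_trans wz; rewrite distrC.
  have := normc_Im_le (z - w); case: z w w0 {zP} => a b [c d] cd0 /=.
  have -> : d = 0 by move: cd0; rewrite lecE /= => /andP[/eqP].
  by rewrite subr0.
(* If the real part of [z] were negative, every point within [- Re z / 2] of [z] would still have a
   negative real part. *)
rewrite leNgt; apply/negP => z0; have e0 : 0 < - (complex.Re z) / 2.
  by rewrite divr_gt0// oppr_gt0.
have [w w0 wz] := zP _ e0.
have := le_trans (normc_Re_le (w - z)) wz.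
case: z w z0 e0 w0 {zP wz} => a b [c d] /= a0 e0 cd0.
have c0 : 0 <= c by move: cd0; rewrite lecE /= => /andP[].
rewrite lecR ger0_norm ?subr_ge0 ?(le_trans (ltW a0))// leNgt => /negP; apply.
rewrite (lt_le_trans (_ : _ < - a)) ?lerDr//.
by rewrite ltr_pdivrMr// mulr_natr mulr2n ltrDl oppr_gt0.
Qed.

Context {T : Type} (F : set_system T) {FF : ProperFilter F}.
Implicit Types (u v : T -> R[i]) (l m : R[i]).

(** Convergence along a filter, with real radii although the norm of [R[i]] is itself
    complex-valued. *)
Definition fcvg u l := forall e, 0 < e -> F (fun n => `|u n - l| < e%:C).

Lemma fcvg_unique u l m : fcvg u l -> fcvg u m -> l = m.
Proof.
move=> ul um; apply/subr0_eq/small_eq0 => e e0.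
have e20 : 0 < e / 2 by rewrite divr_gt0.
have [n [ln mn]] := filter_ex (filterI (ul _ e20) (um _ e20)).
rewrite -(subrKA (u n)) (le_trans (ler_normD _ _))// [e]splitr rmorphD.
by rewrite lerD// ltW// distrC.
Qed.

Lemma eq_fcvg u v l : u =1 v -> fcvg u l -> fcvg v l.
Proof. by move=> /funext ->. Qed.

Lemma near_fcvg u v l : F (fun n => u n = v n) -> fcvg u l -> fcvg v l.
Proof. by move=> uv ul e e0; apply: filterS2 uv (ul _ e0) => n /= ->. Qed.

Lemma fcvg_cst l : fcvg (fun=> l) l.
Proof. by move=> e e0; apply: filterE => n; rewrite subrr normr0 ltcR. Qed.

Lemma fcvgD u v l m : fcvg u l -> fcvg v m -> fcvg (fun n => u n + v n) (l + m).
Proof.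
move=> ul vm e e0; have e20 : 0 < e / 2 by rewrite divr_gt0.
apply: filterS2 (ul _ e20) (vm _ e20) => n ln mn.
rewrite opprD addrACA (le_lt_trans (ler_normD _ _))// [e]splitr rmorphD.
by rewrite ltrD.
Qed.

Lemma fcvg_sum (I : Type) (s : seq I) (u : I -> T -> R[i]) (l : I -> R[i]) :
  (forall i, fcvg (u i) (l i)) ->
  fcvg (fun n => \sum_(i <- s) u i n) (\sum_(i <- s) l i).
Proof.
move=> ul; elim: s => [|i s IH].
  by rewrite big_nil; apply: eq_fcvg (fcvg_cst 0) => n; rewrite big_nil.
rewrite big_cons; apply: eq_fcvg (fcvgD (ul i) IH) => n.
by rewrite big_cons.
Qed.

Lemma fcvgZ a u l : fcvg u l -> fcvg (fun n => a * u n) (a * l).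
Proof.
have [r r0 ar] := norm_complexE a.
move=> ul e e0; have r10 : 0 < r + 1 by rewrite ltr_wpDl.
apply: filterS (ul _ (divr_gt0 e0 r10)) => n ln.
rewrite -mulrBr normrM ar.
have -> : e%:C = (r + 1)%:C * (e / (r + 1))%:C :> R[i].
  by rewrite -rmorphM /= mulrCA divff ?mulr1 ?gt_eqF.
apply: le_lt_trans (_ : (r + 1)%:C * `|u n - l| < _).
  by rewrite ler_wpM2r// lecR lerDl.
by rewrite ltr_pM2l// ltcR.
Qed.

(** From [u v = (u - l) (v - m) + m u + l v - m l], where the first term tends to 0: radius 1 is
    used for [u] and radius [e] for [v]. *)
Lemma fcvgM u v l m : fcvg u l -> fcvg v m -> fcvg (fun n => u n * v n) (l * m).
Proof.
move=> ul vm.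
have uv0 : fcvg (fun n => (u n - l) * (v n - m)) 0.
  move=> e e0; apply: filterS2 (ul _ ltr01) (vm _ e0) => n ln mn.
  by rewrite subr0 normrM -[ltRHS]mul1r ltr_pM.
have := fcvgD uv0 (fcvgD (fcvgZ m ul) (fcvgD (fcvgZ l vm) (fcvg_cst (- (m * l))))).
rewrite add0r addrCA subrr addr0; apply: eq_fcvg => n; ring.
Qed.

Lemma fcvgJ u l : fcvg u l -> fcvg (fun n => (u n)^*%R) l^*%R.
Proof.
move=> ul e e0; apply: filterS (ul _ e0) => n.
by rewrite -rmorphB norm_conjC.
Qed.

Lemma fcvg_ge0 u l : F (fun n => 0 <= u n) -> fcvg u l -> 0 <= l.
Proof.
move=> u0 ul; apply: near_ge0 => e e0.
have [n [n0 ln]] := filter_ex (filterI u0 (ul _ e0)).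
by exists (u n) => //; exact: ltW.
Qed.

Lemma fcvg_le u v l m : F (fun n => u n <= v n) -> fcvg u l -> fcvg v m -> l <= m.
Proof.
move=> uv ul vm; rewrite -subr_ge0; have := fcvgZ (-1) ul.
move=> /(fcvgD vm); rewrite mulN1r; apply: fcvg_ge0.
by apply: filterS uv => n; rewrite mulN1r subr_ge0.
Qed.

End FilterLimit.

Arguments fcvg_unique {R T} F {FF u l m}.
Arguments near_fcvg {R T} F {FF u v l}.
Arguments fcvg_cst {R T} F {FF} l.
Arguments fcvgD {R T} F {FF u v l m}.
Arguments fcvg_sum {R T} F {FF I s u l}.
Arguments fcvgZ {R T} F {FF} a {u l}.
Arguments fcvgM {R T} F {FF u v l m}.
Arguments fcvgJ {R T} F {FF u l}.
Arguments fcvg_ge0 {R T} F {FF u l}.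
Arguments fcvg_le {R T} F {FF u v l m}.

(** * Limits of bounded sequences along a fixed free ultrafilter *)

Section UltraLimit.
Local Open Scope classical_set_scope.

Definition nat_ultra : set_system nat :=
  sval (cid (ultraFilterLemma (eventually_filter))).

#[global] Instance nat_ultra_ultra : UltraFilter nat_ultra.
Proof. by rewrite /nat_ultra; case: cid => ? []. Qed.

Lemma nat_ultra_eventually (A : set nat) : (\forall n \near \oo, A n) -> nat_ultra A.
Proof. by rewrite /nat_ultra; case: cid => F [? +] /=; apply. Qed.

Context {R : realType}.
Implicit Types (u : nat -> R[i]) (l : R[i]) (r : R).

(** Compactness of the segment gives a cluster point. For an ultrafilter a cluster point is a limit:
    otherwise the complement of a neighbourhood would be a large set that avoids it. *)
Lemma bounded_ultra_real (f : nat -> R) r : (forall n, `|f n| <= r) ->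
  exists l : R, forall e : R, 0 < e -> nat_ultra (fun n => `|f n - l| < e).
Proof.
move=> fr; have Ur : (f @ nat_ultra) `[(- r), r].
  change (nat_ultra (f @^-1` `[(- r), r])).
  suff -> : f @^-1` `[(- r), r] = setT by exact: filterT.
  by apply/seteqP; split=> // n _; rewrite /= in_itv /= -ler_norml.
have [l [_ cl]] := @segment_compact R (- r) r _ (fmap_proper_filter f _) Ur.
exists l => e e0; have [//|UnA] := in_ultra_setVsetC
  (fun n => `|f n - l| < e) nat_ultra_ultra.
have [x [/= xA xl]] := cl (~` [set x | `|x - l| < e]) (ball l e) UnA (nbhsx_ballx _ _ e0).
by case: xA; rewrite distrC.
Qed.

Lemma bounded_fcvg u r : (forall n, `|u n| <= r%:C) -> exists l, fcvg nat_ultra u l.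
Proof.
move=> ur.
have [|a aP] := @bounded_ultra_real (fun n => complex.Re (u n)) r.
  by move=> n; rewrite -lecR (le_trans (normc_Re_le _)).
have [|b bP] := @bounded_ultra_real (fun n => complex.Im (u n)) r.
  by move=> n; rewrite -lecR (le_trans (normc_Im_le _)).
exists (Complex a b) => e e0; have e20 : 0 < e / 2 by rewrite divr_gt0.
apply: filterS2 (aP _ e20) (bP _ e20) => n /= ha hb.
apply: le_lt_trans (normc_le_ReIm _) _; rewrite ltcR [ltRHS]splitr.
by case: (u n) ha hb => x y /= ha hb; rewrite ltrD.
Qed.

(** Total by the default value 0; it is meaningful on bounded sequences, where the limit always
    exists. *)
Definition ulim u : R[i] := xget 0 (fcvg nat_ultra u).

Lemma ulimP u (r : R) : (forall n, `|u n| <= r%:C) -> fcvg nat_ultra u (ulim u).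
Proof. by move=> /bounded_fcvg[l ul]; rewrite /ulim; apply: xgetPex; exists l. Qed.

Lemma ulimE u l : fcvg nat_ultra u l -> ulim u = l.
Proof.
move=> ul; apply: (fcvg_unique nat_ultra _ ul); rewrite /ulim; apply: xgetPex.
by exists l.
Qed.

End UltraLimit.

(** * Positive semidefinite matrices *)

Section PsdMatrices.
Local Open Scope sesquilinear_scope.
Context {C : numClosedFieldType}.
Implicit Types (m n d : nat).

(** Row convention: matrices act on row vectors from the right, so eigenvectors below are left
    eigenvectors. *)
Definition mform n (M : 'M[C]_n) (x : 'rV_n) : C := (x *m M *m x ^t*) 0 0.

Definition psdmx n (M : 'M[C]_n) := forall x : 'rV_n, 0 <= mform M x.

Lemma mformE n (M : 'M[C]_n) x :
  mform M x = \sum_i \sum_j x 0 i * M i j * (x 0 j)^*%R.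
Proof.
rewrite /mform mxE exchange_big /=; apply: eq_bigr => j _.
by rewrite !mxE mulr_suml.
Qed.

Lemma mformD n (M N : 'M[C]_n) x : mform (M + N) x = mform M x + mform N x.
Proof. by rewrite /mform mulmxDr mulmxDl mxE. Qed.

Lemma mformZ n a (M : 'M[C]_n) x : mform (a *: M) x = a * mform M x.
Proof. by rewrite /mform -scalemxAr -scalemxAl mxE. Qed.

Lemma mform0 n (x : 'rV[C]_n) : mform 0 x = 0.
Proof. by rewrite /mform mulmx0 mul0mx mxE. Qed.

Lemma mform_sum (T : Type) (s : seq T) (P : pred T) n (M : T -> 'M[C]_n) x :
  mform (\sum_(t <- s | P t) M t) x = \sum_(t <- s | P t) mform (M t) x.
Proof.
apply: (big_morph (fun M => mform M x)) => [A B|]; [exact: mformD|exact: mform0].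
Qed.

Lemma mform1 n (x : 'rV[C]_n) : mform 1%:M x = \sum_i x 0 i * (x 0 i)^*%R.
Proof.
by rewrite /mform mulmx1 mxE; apply: eq_bigr => i _; rewrite !mxE.
Qed.

Lemma mform1_gt0 n (x : 'rV[C]_n) : x != 0 -> 0 < mform 1%:M x.
Proof.
move=> x0; rewrite /mform mulmx1 -dotmxE.
exact: (@dotmx_is_dotmx C).
Qed.

Lemma psdmx1 n : psdmx (1%:M : 'M[C]_n).
Proof. by move=> x; rewrite mform1 sumr_ge0// => i _; rewrite mul_conjC_ge0. Qed.

Lemma psdmx_gram m n (B : 'M[C]_(m, n)) : psdmx (B ^t* *m B).
Proof.
move=> x; rewrite /mform !mulmxA -mulmxA.
have -> : B *m x ^t* = (x *m B ^t*) ^t*.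
  by rewrite trmx_mul map_mxM trmxCK.
rewrite mxE sumr_ge0// => i _.
by rewrite [X in _ * X]mxE [X in _ * X^*%R]mxE mul_conjC_ge0.
Qed.

Lemma mx11_tC (A : 'M[C]_1) : (A ^t*) 0 0 = (A 0 0)^*%R.
Proof. by rewrite !mxE. Qed.

Lemma mform_tC n (M : 'M[C]_n) x : mform (M ^t*) x = (mform M x)^*%R.
Proof.
rewrite /mform -mx11_tC !trmx_mul !map_mxM trmxCK mulmxA.
by [].
Qed.

(* Polarization: over the complex numbers the quadratic form determines the
   sesquilinear one. *)
Lemma mform_eq0 n (M : 'M[C]_n) : (forall x, mform M x = 0) -> M = 0.
Proof.
move=> M0; pose b (x y : 'rV_n) := (x *m M *m y ^t*) 0 0.
have bD x y : b x y + b y x = 0.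
  have := M0 (x + y); rewrite /mform linearD/= map_mxD !mulmxDl !mulmxDr.
  rewrite mxE [X in X + _]mxE [X in _ + X]mxE.
  have := M0 x; have := M0 y; rewrite /mform => -> ->.
  by rewrite add0r addr0.
have b0 x y : b x y = 0.
  have := bD ('i%R *: x) y; rewrite /b.
  rewrite -!scalemxAl linearZ /= map_mxZ -scalemxAr !mxE.
  rewrite /= conjCi mulNr => /eqP; rewrite subr_eq0 => /eqP h.
  have {}h : b x y = b y x.
    have := mulfI (neq0Ci C) h. by rewrite /b !mxE.
  have := bD x y; rewrite -h -mulr2n => /eqP.
  by rewrite mulrn_eq0 /= => /eqP; rewrite /b mxE.
apply/matrixP => i j; rewrite [RHS]mxE -(b0 (delta_mx 0 i) (delta_mx 0 j)).
rewrite /b -rowE -map_trmx map_delta_mx.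
by rewrite trmx_delta -colE !mxE.
Qed.

(** The forms of [M ^t*] and [M] are conjugate to each other, hence equal when real; polarization
    then identifies the matrices. *)
Lemma psdmx_herm n (M : 'M[C]_n) : psdmx M -> M ^t* = M.
Proof.
move=> M0; apply/subr0_eq/mform_eq0 => x.
rewrite mformD mform_tC -scaleN1r mformZ mulN1r.
by rewrite (CrealP _) ?subrr// ger0_real.
Qed.

Lemma herm_spectral n (M : 'M[C]_n) : M ^t* = M ->
  exists2 P : 'M_n, P \is unitarymx &
  exists D : 'rV_n, M = P ^t* *m diag_mx D *m P.
Proof.
move=> MH.
have /orthomx_spectralP MP : M \is normalmx by apply/normalmxP; rewrite MH.
exists (spectralmx M); first exact: spectral_unitarymx.
exists (spectral_diag M); rewrite -invmx_unitary//.
exact: spectral_unitarymx.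
Qed.

Lemma spectral_row n (M P : 'M[C]_n) (D : 'rV_n) i : P \is unitarymx ->
  M = P ^t* *m diag_mx D *m P -> row i P *m M = D 0 i *: row i P.
Proof.
move=> PU ->; rewrite !mulmxA rowE -(mulmxA _ P) (unitarymxP PU) mulmx1.
rewrite -rowE row_diag_mx -scalemxAl.
by [].
Qed.

Lemma spectral_row_neq0 n (P : 'M[C]_n) i : P \is unitarymx -> row i P != 0.
Proof.
move=> /row_unitarymxP/(_ i i); rewrite eqxx; apply: contra_eqN => /eqP ->.
by rewrite dotmxE mul0mx mxE eq_sym oner_eq0.
Qed.

Lemma mform_eigen n (M : 'M[C]_n) x a : x *m M = a *: x ->
  mform M x = a * mform 1%:M x.
Proof. by move=> xM; rewrite /mform xM mulmx1 -scalemxAl mxE. Qed.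

(** The factor is the square root of the diagonal part times the diagonalizing unitary. The
    hypothesis is put on eigenvalues because they are what the transfer from Kronecker products to
    ordinary products controls. *)
Lemma herm_factor n (M : 'M[C]_n) : M ^t* = M ->
  (forall (x : 'rV_n) a, x != 0 -> x *m M = a *: x -> 0 <= a) ->
  exists B : 'M_n, M = B ^t* *m B.
Proof.
move=> Mh M0; have [P PU [D MD]] := herm_spectral Mh.
have D0 i : 0 <= D 0 i.
  exact: M0 (spectral_row_neq0 i PU) (spectral_row i PU MD).
exists (diag_mx (map_mx sqrtC D) *m P).
rewrite trmx_mul map_mxM tr_diag_mx map_diag_mx !mulmxA.
rewrite -(mulmxA (P ^t*)) mulmx_diag MD; congr (_ *m diag_mx _ *m _).
apply/rowP => i; rewrite !mxE /= (CrealP _) ?ger0_real ?sqrtC_ge0//.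
by rewrite -expr2 sqrtCK.
Qed.

Lemma psdmx_factor n (M : 'M[C]_n) : psdmx M -> exists B : 'M_n, M = B ^t* *m B.
Proof.
move=> M0; apply: herm_factor => [|x a x0 /mform_eigen xa]; first exact: psdmx_herm.
by have := M0 x; rewrite xa pmulr_lge0// mform1_gt0.
Qed.

(** A Kronecker product of Gram matrices is the Gram matrix of the Kronecker product of the
    factors. *)
Lemma psdmx_tens m n (M : 'M[C]_m) (N : 'M[C]_n) :
  psdmx M -> psdmx N -> psdmx (M *t N).
Proof.
move=> /psdmx_factor[A ->] /psdmx_factor[B ->].
rewrite -tensmx_mul -map_mxT -trmx_tens; exact: psdmx_gram.
Qed.

(* [M - M ^+ 2 = M (1 - M) M + (1 - M) M (1 - M)] *)
Lemma psdmx_contr n (M : 'M[C]_n) x : psdmx M -> psdmx (1%:M - M) ->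
  mform 1%:M (x *m M) <= mform 1%:M x.
Proof.
move=> M0 M1; have Mh := psdmx_herm M0.
have mE y A B : mform A (y *m B) = mform (B *m A *m B ^t*) y.
  by rewrite /mform trmx_mul map_mxM !mulmxA.
apply: (@le_trans _ _ (mform M x)); last first.
  rewrite -subr_ge0; have := M1 x.
  by rewrite mformD -scaleN1r mformZ mulN1r.
rewrite mE mulmx1 Mh -subr_ge0.
rewrite -mulN1r -mformZ -mformD scaleN1r.
pose N := 1%:M - M.
have Nh : N ^t* = N by apply: psdmx_herm.
have -> : M - M *m M = M *m N *m M ^t* + N *m M *m N ^t*.
  have -> : N *m M = M *m N by rewrite mulmxBl mulmxBr mul1mx mulmx1.
  by rewrite Mh Nh -mulmxDr [M + N]addrC subrK mulmx1 mulmxBr mulmx1.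
by rewrite mformD -!mE addr_ge0.
Qed.

End PsdMatrices.

(** * Transfer of positivity from Kronecker products to products of commuting matrices *)

Section Contraction.
Local Open Scope sesquilinear_scope.
Context {C : numClosedFieldType}.

Lemma sum_mxtens m n (V : nmodType) (F : 'I_(m * n) -> V) :
  \sum_k F k = \sum_i \sum_j F (mxtens_index (i, j)).
Proof.
rewrite pair_bigA (reindex (@mxtens_index m n)) /=.
  by apply: eq_bigr => -[].
by exists (@mxtens_unindex m n) => [[i j]|k] _; rewrite ?mxtens_indexK ?mxtens_unindexK.
Qed.

(* The value at [X *t Y] is [X *m Y]. *)
Definition mxtens_contr d (Z : 'M[C]_(d * d)) : 'M_d :=
  \matrix_(i, l) \sum_j Z (mxtens_index (i, j)) (mxtens_index (j, l)).

Lemma mxtens_contrD d (Z W : 'M[C]_(d * d)) :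
  mxtens_contr (Z + W) = mxtens_contr Z + mxtens_contr W.
Proof.
by apply/matrixP => i l; rewrite !mxE -big_split; apply: eq_bigr => j _; rewrite mxE.
Qed.

Lemma mxtens_contrZ d a (Z : 'M[C]_(d * d)) :
  mxtens_contr (a *: Z) = a *: mxtens_contr Z.
Proof.
by apply/matrixP => i l; rewrite !mxE mulr_sumr; apply: eq_bigr => j _; rewrite mxE.
Qed.

Lemma mxtens_contr0 d : mxtens_contr (0 : 'M[C]_(d * d)) = 0.
Proof. by rewrite -(scale0r 0) mxtens_contrZ scale0r. Qed.

Lemma mxtens_contr_sum (T : Type) (s : seq T) (P : pred T) d (Z : T -> 'M[C]_(d * d)) :
  mxtens_contr (\sum_(t <- s | P t) Z t) = \sum_(t <- s | P t) mxtens_contr (Z t).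
Proof. exact: (big_morph _ (@mxtens_contrD d) (mxtens_contr0 d)). Qed.

Lemma mxtens_contr1 d : mxtens_contr (1%:M : 'M[C]_(d * d)) = 1%:M.
Proof.
apply/matrixP => i l; rewrite !mxE.
under eq_bigr do rewrite mxE (can_eq (@mxtens_indexK d d)) xpair_eqE.
rewrite (bigD1 i) //= eqxx /= big1 ?addr0// => j /negbTE ji.
by rewrite eq_sym ji.
Qed.

Lemma mxtens_contrMl d (X : 'M[C]_d) Z :
  mxtens_contr ((X *t 1%:M) *m Z) = X *m mxtens_contr Z.
Proof.
apply/matrixP => i l; rewrite !mxE.
under [RHS]eq_bigr do rewrite mxE mulr_sumr.
rewrite [RHS]exchange_big /=; apply: eq_bigr => j _.
rewrite mxE sum_mxtens; apply: eq_bigr => a _.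
under eq_bigr do rewrite tensmxE mxE.
rewrite (bigD1 j) //= eqxx mulr1 big1 ?addr0// => b /negbTE bj.
by rewrite eq_sym bj mulr0 mul0r.
Qed.

(** [Y] acts on the column index of the first factor or on the row index of the second one; these
    two are summed over together, so [Y] slides across. *)
Lemma mxtens_contrMr d (Y : 'M[C]_d) Z :
  mxtens_contr ((1%:M *t Y) *m Z) = mxtens_contr (Z *m (Y *t 1%:M)).
Proof.
apply/matrixP => i l; rewrite !mxE.
transitivity (\sum_j \sum_b Y j b * Z (mxtens_index (i, b)) (mxtens_index (j, l))).
  apply: eq_bigr => j _; rewrite mxE sum_mxtens (bigD1 i) //= [X in _ + X]big1 ?addr0.
    by apply: eq_bigr => b _; rewrite tensmxE mxE eqxx mul1r.
  move=> a /negbTE ai; rewrite big1// => b _.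
  by rewrite tensmxE mxE eq_sym ai !mul0r.
rewrite exchange_big /=; apply: eq_bigr => b _.
rewrite mxE sum_mxtens; apply: eq_bigr => j _.
rewrite (bigD1 l) //= big1 ?addr0.
  by rewrite tensmxE mxE eqxx mulr1 mulrC.
by move=> a /negbTE al; rewrite tensmxE mxE al !mulr0.
Qed.

(** Powers as iterated products make sense for every size, including 0. *)
Definition mxpow n (A : 'M[C]_n) k : 'M_n := iter k (mulmx A) 1%:M.

Lemma char_poly_mxpow n (A : 'M[C]_n) :
  \sum_(k < size (char_poly A)) (char_poly A)`_k *: mxpow A k = 0.
Proof.
case: n A => [|n] A; first by rewrite flatmx0.
rewrite -[RHS](Cayley_Hamilton A) /horner_mx /horner_morph.
rewrite (@horner_coef_wide _ (size (char_poly A))) ?size_map_poly//.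
apply: eq_bigr => k _; rewrite coef_map /= -mul_scalar_mx; congr (_ *m _).
by rewrite /mxpow; elim: (nat_of_ord k) => [//|j IH]; rewrite exprS /= IH.
Qed.

Lemma mxpow_eigen n (A : 'M[C]_n) (x : 'rV_n) a k :
  x *m A = a *: x -> x *m mxpow A k = a ^+ k *: x.
Proof.
move=> xA; elim: k => [|k IH]; first by rewrite mulmx1 scale1r.
by rewrite /mxpow /= mulmxA xA -scalemxAl -/(mxpow A k) IH scalerA exprS.
Qed.

Context {d : nat} {K : finType} (X Y : K -> 'M[C]_d) (c : K -> C) (s : C).
Hypothesis XY : forall k l, X k *m Y l = Y l *m X k.

Let T := \sum_k c k *: (X k *t Y k) + s *: 1%:M.
Let S := \sum_k c k *: (X k *m Y k) + s *: 1%:M.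

(** Induction, carried along with the fact that powers of [T] commute with [Y l *t 1%:M]. In a
    summand, [X] leaves the contraction on the left, while [Y] slides to the right of [mxpow T k],
    commutes past it and leaves as well. *)
Lemma mxtens_contr_mxpow k : mxtens_contr (mxpow T k) = mxpow S k.
Proof.
suff: (forall l, mxpow T k *m (Y l *t 1%:M) = (Y l *t 1%:M) *m mxpow T k) /\
    mxtens_contr (mxpow T k) = mxpow S k by case.
elim: k => [|k [IHc IH]].
  by split=> [l|]; rewrite /mxpow /= ?mulmx1 ?mul1mx// mxtens_contr1.
have TY l : T *m (Y l *t 1%:M) = (Y l *t 1%:M) *m T.
  rewrite mulmxDl mulmxDr; congr (_ + _); last first.
    by rewrite -scalemxAl -scalemxAr mul1mx mulmx1.
  rewrite mulmx_suml mulmx_sumr; apply: eq_bigr => i _.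
  by rewrite -scalemxAl -scalemxAr !tensmx_mul XY mulmx1 mul1mx.
split=> [l|]; first by rewrite /mxpow /= -/(mxpow T k) -mulmxA IHc !mulmxA TY.
rewrite /mxpow /= -/(mxpow T k) -/(mxpow S k) mulmxDl mxtens_contrD mulmxDl.
congr (_ + _); last by rewrite -!scalemxAl !mul1mx mxtens_contrZ IH.
rewrite !mulmx_suml mxtens_contr_sum; apply: eq_bigr => i _.
rewrite -!scalemxAl mxtens_contrZ; congr (_ *: _).
have -> : X i *t Y i = (X i *t 1%:M) *m (1%:M *t Y i).
  by rewrite tensmx_mul mul1mx mulmx1.
by rewrite -!mulmxA mxtens_contrMl mxtens_contrMr IHc mxtens_contrMl IH.
Qed.

(* The characteristic polynomial of [T] annihilates [S]. *)
Lemma psdmx_mul_of_tens : S ^t* = S -> psdmx T -> psdmx S.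
Proof.
move=> Sh T0; suff [B ->] : exists B : 'M_d, S = B ^t* *m B by exact: psdmx_gram.
apply: herm_factor => // x a x0 xS.
(* Contract the Cayley-Hamilton identity of [T] and multiply by the eigenvector [x] of [S]: the
   characteristic polynomial of [T] vanishes at [a], so [a] is an eigenvalue of [T]. *)
have /(congr1 (@mxtens_contr d)) := char_poly_mxpow T.
rewrite mxtens_contr0 mxtens_contr_sum => /(congr1 (mulmx x)).
rewrite mulmx0 mulmx_sumr.
under eq_bigr do rewrite mxtens_contrZ mxtens_contr_mxpow -scalemxAr
  (mxpow_eigen _ xS) scalerA.
rewrite -scaler_suml -horner_coef => /eqP.
rewrite scaler_eq0 (negbTE x0) orbF -/(root _ _) -eigenvalue_root_char.
move=> /eigenvalueP[v /mform_eigen va v0].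
by have := T0 v; rewrite va pmulr_lge0// mform1_gt0.
Qed.

End Contraction.

(** * Convex separation *)

Section Separation.
Local Open Scope classical_set_scope.
Context {R : realType} {Q : finType}.
Implicit Types (x y p c : Q -> R).

Let dist2 p x := \sum_k (x k - p k) ^+ 2.

(* If [p] is at distance [sqrt d > 0] from [D], then moving from a nearly
   nearest point [x] slightly towards a [y] in [C] with
   [<x - p, y - p> < d / 4] brings us strictly closer to [p] than [sqrt d]. *)
Lemma convex_separation (p : Q -> R) (D : set (Q -> R)) (M : R) :
  (forall x y (t : R), D x -> D y -> 0 <= t <= 1 ->
     D (fun k => (1 - t) * x k + t * y k)) ->
  (forall x k, D x -> `|x k| <= M) ->
  (forall c (s : R), (forall x, D x -> 0 <= \sum_k c k * x k + s) ->
     0 <= \sum_k c k * p k + s) ->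
  forall e : R, 0 < e -> exists2 x, D x & forall k, `|x k - p k| < e.
Proof.
move=> Dconv Dbnd Dsep.
(* For empty [D] the constant functional -1 would contradict the separation hypothesis. *)
have [x0 Dx0] : exists x, D x.
  apply: contrapT => /forallNP D0; have := Dsep (fun=> 0) (-1).
  rewrite big1 ?add0r => [|k _]; last by rewrite mul0r.
  rewrite oppr_ge0 ler10 => h.
  by suff : false by []; apply: h => x /D0.
pose E := [set dist2 p x | x in D]; pose d := inf E.
have hE : has_inf E.
  split; first by exists (dist2 p x0), x0.
  by exists 0 => _ [x _ <-]; apply: sumr_ge0 => k _; rewrite sqr_ge0.
have dE x : D x -> d <= dist2 p x by move=> Dx; apply: (ge_inf hE.2); exists x.
have d_le0 : d <= 0.
  rewrite leNgt; apply/negP => d0.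
  pose B := \sum_(k : Q) (M + `|p k|) ^+ 2.
  have B0 : 0 <= B by apply: sumr_ge0 => k _; rewrite sqr_ge0.
  have DB x : D x -> dist2 p x <= B.
    move=> Dx; apply: ler_sum => k _; rewrite -real_normK ?num_real//.
    rewrite lerXn2r ?nnegrE ?addr_ge0 ?(le_trans _ (Dbnd x k Dx))//.
    by rewrite (le_trans (ler_normB _ _))// lerD2r; exact: Dbnd.
  have nz : 0 < 2 * (2 * d + B) by rewrite mulr_gt0// ltr_wpDr// mulr_gt0.
  (* Chosen so that [t * (2 * d + B) = d / 2]. The same [t] measures how close [x] is to being
     nearest: its squared distance is below [d + t * d]. *)
  pose t := d / (2 * (2 * d + B)).
  have t0 : 0 < t by rewrite divr_gt0.
  have tE : t * (2 * d + B) = d / 2.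
    by rewrite /t; field; rewrite gt_eqF//; lra.
  have t1 : t <= 1.
    by rewrite ler_pdivrMr// mul1r; lra.
  have [_ [x Dx <-]] := inf_adherent (mulr_gt0 t0 d0) hE.
  rewrite -/d => xd.
  (* Otherwise the affine functional [<x - p, . - p> - d / 4] is nonnegative on [D], hence at [p],
     where its value is [- d / 4]. *)
  have [y Dy xy] : exists2 y, D y & \sum_k (x k - p k) * (y k - p k) < d / 4.
    apply: contrapT => /forall2NP nxy.
    have := Dsep (fun k => x k - p k) (- (\sum_k (x k - p k) * p k) - d / 4).
    rewrite addrA subrr add0r oppr_ge0.
    move=> /(_ _) h; suff : d / 4 <= 0 by rewrite leNgt divr_gt0.
    apply: h => y Dy; have [//|/negP] := nxy y.
    rewrite -leNgt addrA -sumrB => h; rewrite subr_ge0 (le_trans h)//.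
    by apply: ler_sum => k _; rewrite mulrBr.
  have := dE _ (Dconv x y t Dx Dy _); rewrite t1 ltW// => /(_ isT).
  have -> : dist2 p (fun k => (1 - t) * x k + t * y k) =
     (1 - t) ^+ 2 * dist2 p x + 2 * t * (1 - t) *
     (\sum_k (x k - p k) * (y k - p k)) + t ^+ 2 * dist2 p y.
    rewrite /dist2 !mulr_sumr -!big_split /=; apply: eq_bigr => k _; ring.
  set b := \sum_k _ in xy *; have := dE x Dx; have := DB y Dy.
  set u := dist2 p x in xd *; set v := dist2 p y.
  move=> vB du; apply/negP; rewrite -ltNge.
  have tdd : t * d <= d by rewrite ler_piMl// ltW.
  (* With [u < d + t d] and [v <= B], the second-order term and the cross term are each at most
     [t d / 2]. The new squared distance is thus at most [u - 2 t d + t d = u - t d < d], a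
     contradiction. *)
  have h1 : t ^+ 2 * (u + v) <= t * (d / 2).
    rewrite expr2 -mulrA ler_pM2l// -tE ler_pM2l//; lra.
  have h2 : 2 * t * (1 - t) * b <= t * (d / 2).
    apply: (@le_trans _ _ (2 * t * (1 - t) * (d / 4))).
      by rewrite ler_wpM2l ?(ltW xy)// mulr_ge0 ?subr_ge0// mulr_ge0// ltW.
    have : t * (1 - t) * d <= t * d.
      by rewrite ler_wpM2r ?(ltW d0)// ler_piMr ?(ltW t0)// lerBlDr lerDl ltW.
    lra.
  have h3 : t * d <= t * u by rewrite ler_pM2l.
  have -> : (1 - t) ^+ 2 * u + 2 * t * (1 - t) * b + t ^+ 2 * v =
    u - 2 * (t * u) + t ^+ 2 * (u + v) + 2 * t * (1 - t) * b by ring.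
  lra.
move=> e e0; have [|_ [x Dx <-]] := @inf_adherent _ E (e ^+ 2) _ hE.
  by rewrite exprn_gt0.
rewrite -/d => xe; exists x => // k.
rewrite -(ltr_pXn2r (n := 2)) ?nnegrE ?(ltW e0)// real_normK ?num_real//.
apply: le_lt_trans (_ : dist2 p x < _); last first.
  by apply: lt_le_trans xe _; rewrite gerDr.
by rewrite /dist2 (bigD1 k)//= lerDl sumr_ge0// => i _; rewrite sqr_ge0.
Qed.

End Separation.

(** * Square-summable families *)

Lemma normB_sqr_ge0 (C : numClosedFieldType) (a b : C) : 0 <= (`|a| - `|b|) ^+ 2.
Proof. by rewrite real_exprn_even_ge0// rpredB ?normr_real. Qed.

Section DotNorm.
Context {C : numClosedFieldType} {V : lmodType C} (f : {dot V for @Num.conj C}).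
Implicit Types (x y : V).

Lemma dotC x y : f x y = (f y x)^*%R.
Proof. by rewrite hermC /= expr0 mul1r. Qed.

Lemma dot_ge0 x : 0 <= f x x.
Proof.
have [->|x0] := eqVneq x 0; first by rewrite linear0l.
by rewrite ltW// neq0_dnorm_gt0.
Qed.

Lemma dot_cauchy_schwarz x y : `|f x y| ^+ 2 <= f x x * f y y.
Proof.
have [->|y0] := eqVneq y 0; first by rewrite !linear0r normr0 expr0n mulr0.
have fy : 0 < f y y by rewrite neq0_dnorm_gt0.
(* Expand the square of the component of [x] orthogonal to [y]. *)
have := dot_ge0 (x - (f x y / f y y) *: y).
rewrite linearBl !linearBr !linearZl_LR !linearZr_LR /=.
have -> : f y x = (f x y)^*%R by rewrite -dotC.
have bJ : (f y y)^*%R = f y y by rewrite -dotC.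
rewrite rmorphM fmorphV /= bJ; set a := f x y; set b := f y y.
have -> : f x x - a^*%R / b * a - (a / b * a^*%R - a / b * (a^*%R / b * b)) =
   f x x - (a * a^*%R) / b.
  have b0 : b != 0 by rewrite gt_eqF.
  by field.
by rewrite subr_ge0 ler_pdivrMr// -normCK.
Qed.

Lemma dot_triangle x y :
  sqrtC (f (x + y) (x + y)) <= sqrtC (f x x) + sqrtC (f y y).
Proof.
have s0 z : 0 <= sqrtC (f z z) by rewrite sqrtC_ge0 dot_ge0.
rewrite -[leRHS]sqrCK ?addr_ge0// ler_sqrtC ?nnegrE ?dot_ge0//; last first.
  by rewrite exprn_ge0// addr_ge0.
have -> : f (x + y) (x + y) = f x x + (f x y + (f x y)^*%R + f y y).
  by rewrite -dotC linearDl !linearDr /= !addrA.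
rewrite sqrrD !sqrtCK -!addrA lerD2l [leLHS]addrA [leRHS]addrA lerD2r.
have fxy : `|f x y| <= sqrtC (f x x) * sqrtC (f y y).
  rewrite -sqrtCM ?nnegrE ?dot_ge0// -[leLHS]sqrCK// ler_sqrtC ?nnegrE ?exprn_ge0//.
    exact: dot_cauchy_schwarz.
  by rewrite mulr_ge0 ?dot_ge0.
have h : f x y + (f x y)^*%R \is Num.real.
  by apply/CrealP; rewrite rmorphD /= conjCK addrC.
apply: le_trans (real_ler_norm h) _.
apply: le_trans (ler_normD _ _) _.
by rewrite norm_conjC lerD.
Qed.

Lemma sqrt_dotZ a x : sqrtC (f (a *: x) (a *: x)) = `|a| * sqrtC (f x x).
Proof.
rewrite linearZl_LR linearZr_LR /= mulrA -normCK.
by rewrite sqrtCM ?nnegrE ?exprn_ge0 ?dot_ge0// sqrCK.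
Qed.

Lemma sqrt_dot_eq0 x : sqrtC (f x x) = 0 -> x = 0.
Proof.
move=> /eqP; rewrite sqrtC_eq0 => fx; apply/eqP; apply: contraTT fx => x0.
by rewrite gt_eqF// neq0_dnorm_gt0.
Qed.

End DotNorm.

(* The infinite sums over an index set are limits along a fixed increasing
   exhaustion by finite subsets: for square exhaustions of a product, partial
   sums of products factor exactly. *)
Record exhaustion := Exhaustion {
  exh_sort :> choiceType;
  exh_seq : nat -> seq exh_sort;
  exh_uniq : forall n, uniq (exh_seq n);
  exh_mono : forall m n, (m <= n)%N -> {subset exh_seq m <= exh_seq n};
  exh_cover : forall s, exists n, s \in exh_seq n }.

Section L2.
Local Open Scope classical_set_scope.
Context (R : realType) (E : exhaustion).
Local Notation C := R[i].
Implicit Types (x y : E -> C) (n : nat).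

Definition pdot n x y : C := \sum_(s <- exh_seq E n) x s * (y s)^*%R.

Lemma pdot_ge0 n x : 0 <= pdot n x x.
Proof. by apply: sumr_ge0 => s _; rewrite mul_conjC_ge0. Qed.

Lemma pdotC n x y : pdot n x y = (pdot n y x)^*%R.
Proof.
rewrite rmorph_sum; apply: eq_bigr => s _.
by rewrite rmorphM /= conjCK mulrC.
Qed.

Lemma pdotDZl n a x y z :
  pdot n (fun s => a * x s + y s) z = a * pdot n x z + pdot n y z.
Proof.
by rewrite mulr_sumr -big_split; apply: eq_bigr => s _ /=; rewrite mulrDl mulrA.
Qed.

Lemma sum_exh_sub (f : E -> C) m n : (m <= n)%N ->
  \sum_(s <- exh_seq E n) f s = \sum_(s <- exh_seq E m) f s +
    \sum_(s <- exh_seq E n | s \notin exh_seq E m) f s.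
Proof.
move=> mn; rewrite (bigID (mem (exh_seq E m))) /=; congr (_ + _).
rewrite -big_filter; apply: perm_big; apply: uniq_perm.
- by rewrite filter_uniq ?exh_uniq.
- exact: exh_uniq.
move=> s; rewrite mem_filter andb_idr//; exact: exh_mono.
Qed.

Lemma pdot_mono m n x : (m <= n)%N -> pdot m x x <= pdot n x x.
Proof.
move=> mn; rewrite /pdot (sum_exh_sub _ mn) lerDl sumr_ge0// => s _.
by rewrite mul_conjC_ge0.
Qed.

Lemma norm_le_pdot n x s : s \in exh_seq E n -> `|x s| ^+ 2 <= pdot n x x.
Proof.
move=> sn; rewrite /pdot (bigD1_seq s) ?exh_uniq//= normCK lerDl.
by rewrite sumr_ge0// => i _; rewrite mul_conjC_ge0.
Qed.

Lemma pdotD_le n x y : pdot n (fun s => x s + y s) (fun s => x s + y s) <=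
  2 * (pdot n x x + pdot n y y).
Proof.
rewrite /pdot -big_split mulr_sumr; apply: ler_sum => s _ /=.
rewrite -!normCK; apply: (@le_trans _ _ ((`|x s| + `|y s|) ^+ 2)).
  by rewrite lerXn2r ?nnegrE ?addr_ge0 ?ler_normD.
rewrite -subr_ge0; have -> : 2 * (`|x s| ^+ 2 + `|y s| ^+ 2) -
  (`|x s| + `|y s|) ^+ 2 = (`|x s| - `|y s|) ^+ 2 :> C by ring.
exact: normB_sqr_ge0.
Qed.

Lemma pdotZ n a x : pdot n (fun s => a * x s) (fun s => a * x s) =
  `|a| ^+ 2 * pdot n x x.
Proof.
rewrite mulr_sumr; apply: eq_bigr => s _.
by rewrite rmorphM /= mulrACA -normCK.
Qed.

Definition l2_pred : pred (E -> C) := fun x =>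
  `[< exists M : R, forall n, pdot n x x <= M%:C >].

Lemma l2_predP x : reflect (exists M : R, forall n, pdot n x x <= M%:C) (x \in l2_pred).
Proof. exact: asboolP. Qed.

Lemma l2_submod : submod_closed l2_pred.
Proof.
split=> [|a x y /l2_predP[M xM] /l2_predP[N yN]].
  by apply/l2_predP; exists 0 => n; rewrite /pdot big1// => s _; rewrite mul0r.
have [r r0 ar] := norm_complexE a.
apply/l2_predP; exists (2 * (r ^+ 2 * M + N)) => n.
apply: le_trans (pdotD_le n (fun s => a * x s) y) _.
have -> : (2 * (r ^+ 2 * M + N))%:C = 2 * (r%:C ^+ 2 * M%:C + N%:C) :> C.
  by rewrite !(rmorphM, rmorphD, rmorphXn).
rewrite pdotZ ar.
rewrite ler_pM2l; last by rewrite (ltr0n _ 2).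
by rewrite lerD// ler_wpM2l// exprn_ge0// ler0c.
Qed.

HB.instance Definition _ :=
  GRing.isSubmodClosed.Build C (E -> C) l2_pred l2_submod.

Record l2 := L2 { l2_fun :> E -> C; l2P : l2_fun \in l2_pred }.

HB.instance Definition _ := [isSub for l2_fun].
HB.instance Definition _ := [Choice of l2 by <:].
HB.instance Definition _ := [SubChoice_isSubLmodule of l2 by <:].

Lemma l2_eq (x y : l2) : x =1 y -> x = y.
Proof. by move=> xy; apply/val_inj/funext. Qed.

Lemma l2DE (x y : l2) s : (x + y) s = x s + y s. Proof. by []. Qed.
Lemma l2NE (x : l2) s : (- x) s = - x s. Proof. by []. Qed.
Lemma l2_sumE (T : Type) (r : seq T) (P : pred T) (x : T -> l2) s :
  (\sum_(t <- r | P t) x t) s = \sum_(t <- r | P t) x t s.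
Proof. by elim/big_rec2: _ => // t a y _ <-. Qed.

(** With the ultrafilter limit, existence follows from boundedness of the partial sums alone, and
    algebraic identities pass from partial sums to the limit. *)
Definition l2_dot (x y : l2) : C := ulim (fun n => pdot n x y).

Lemma l2_dot_cvg (x y : l2) : fcvg nat_ultra (fun n => pdot n x y) (l2_dot x y).
Proof.
have /l2_predP[M xM] := l2P x; have /l2_predP[N yN] := l2P y.
(* The bound comes from [|a b| <= |a|^2 + |b|^2] in each coordinate. *)
apply: (@ulimP _ _ (M + N)) => n; rewrite rmorphD.
apply: le_trans (_ : pdot n x x + pdot n y y <= _); last exact: lerD.
rewrite /pdot -big_split; apply: le_trans (ler_norm_sum _ _ _) _.
apply: ler_sum => s _ /=; rewrite normrM norm_conjC -!normCK -subr_ge0.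
have -> : `|x s| ^+ 2 + `|y s| ^+ 2 - `|x s| * `|y s| =
  (`|x s| - `|y s|) ^+ 2 + `|x s| * `|y s| :> C by ring.
by rewrite addr_ge0 ?normB_sqr_ge0 ?mulr_ge0.
Qed.

Lemma l2_dotE (x y : l2) l : fcvg nat_ultra (fun n => pdot n x y) l -> l2_dot x y = l.
Proof. exact: ulimE. Qed.

Lemma pdot_le_dot n (x : l2) : pdot n x x <= l2_dot x x.
Proof.
apply: (fcvg_le nat_ultra _ (fcvg_cst nat_ultra _) (l2_dot_cvg x x)).
apply: nat_ultra_eventually; exists n => // m /=; exact: pdot_mono.
Qed.

Lemma dot_le_pdot (x : l2) l : (forall n, pdot n x x <= l) -> l2_dot x x <= l.
Proof.
by move=> xl; apply: (fcvg_le nat_ultra _ (l2_dot_cvg x x) (fcvg_cst nat_ultra _)); exact: filterE.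
Qed.

Lemma l2_dotC (x y : l2) : l2_dot x y = (-1) ^+ false * (l2_dot y x)^*%R.
Proof.
rewrite expr0 mul1r; apply: l2_dotE.
apply: (eq_fcvg _ (fcvgJ nat_ultra (l2_dot_cvg y x))) => n.
by rewrite [RHS]pdotC.
Qed.

Lemma l2_dot_linear z : linear_for *%R (l2_dot^~ z).
Proof.
move=> a x y; apply: l2_dotE.
apply: (eq_fcvg _ (fcvgD nat_ultra (fcvgZ nat_ultra a (l2_dot_cvg x z))
  (l2_dot_cvg y z))) => n.
by rewrite -pdotDZl.
Qed.

Lemma l2_dot_linearr z : linear_for (@Num.conj C \; *%R) (l2_dot z).
Proof.
move=> a x y; rewrite [LHS]l2_dotC l2_dot_linear rmorphD rmorphM /=.
by rewrite [in RHS]l2_dotC [in X in _ = _ + X]l2_dotC !expr0 !mul1r.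
Qed.

HB.instance Definition _ := @bilinear_isBilinear.Build C l2 l2 C *%R
  (@Num.conj C \; *%R) l2_dot (l2_dot_linear, l2_dot_linearr).

HB.instance Definition _ := @isHermitianSesquilinear.Build C l2 false
  (@Num.conj C) l2_dot l2_dotC.

Lemma l2_dot_gt0 (x : l2) : x != 0 -> 0 < l2_dot x x.
Proof.
move=> x0; suff [s xs] : exists s, x s != 0.
  have [n sn] := exh_cover s.
  apply: lt_le_trans (pdot_le_dot n x).
  by apply: lt_le_trans (norm_le_pdot x sn); rewrite exprn_gt0// normr_gt0.
apply: contrapT => /forallNP xs; case/eqP: x0; apply: l2_eq => s.
by apply/eqP/negPn/negP; exact: xs.
Qed.

HB.instance Definition _ := @isDotProduct.Build C l2 l2_dot l2_dot_gt0.

HB.instance Definition _ := @Lmodule_isNormed.Build C l2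
  (fun x : l2 => sqrtC (l2_dot x x)) (dot_triangle l2_dot)
  (sqrt_dotZ l2_dot) (sqrt_dot_eq0 (f := l2_dot)).

Lemma l2_normE (x : l2) : `|x| ^+ 2 = l2_dot x x.
Proof. by rewrite [LHS]sqrtCK. Qed.

End L2.

Lemma gt0_complexE (R : realType) (e : R[i]) : 0 < e -> exists2 r : R, 0 < r & e = r%:C.
Proof.
move=> e0; exists (complex.Re e); last by rewrite RRe_real ?gtr0_real.
by rewrite -ltcR RRe_real ?gtr0_real.
Qed.

(** * Completeness, and density of finitely supported families *)

Section L2Complete.
Local Open Scope classical_set_scope.
Context {R : realType} {E : exhaustion}.
Local Notation C := R[i].
Implicit Types (x y : l2 R E) (n : nat).

Lemma norm_le_l2 x s : `|x s| <= `|x|.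
Proof.
have [n sn] := exh_cover s.
rewrite -(ler_pXn2r (ltn0Sn 1)) ?nnegrE ?l2_normE//.
exact: le_trans (norm_le_pdot x sn) (pdot_le_dot n x).
Qed.

Lemma l2_norm_le x (e : C) : 0 <= e -> (forall n, pdot n x x <= e ^+ 2) -> `|x| <= e.
Proof.
move=> e0 xe; rewrite -(ler_pXn2r (ltn0Sn 1)) ?nnegrE ?l2_normE//.
exact: dot_le_pdot.
Qed.

Lemma cauchy_fcvg (T : Type) (F : set_system T) (u : T -> C) : ProperFilter F ->
  (forall e : R, 0 < e -> exists2 A, F A & forall x y : T, A x -> A y ->
    `|u x - u y| < e%:C) ->
  exists l, fcvg F u l.
Proof.
move=> FF uc.
have cv (f : C -> R) : (forall z, `|f z|%:C <= `|z|) ->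
    (forall z w, f (z - w) = f z - f w) ->
    exists l : R, forall e : R, 0 < e -> F (fun x : T => `|f (u x) - l| < e).
  move=> fle fB; have : cauchy ((f \o u) @ F).
    apply/cauchy_ballP => e e0; have [A FA Ae] := uc e e0.
    have GA : ((f \o u) @ F) [set f (u x) | x in A].
      change (F ((f \o u) @^-1` [set f (u x) | x in A])).
      by apply: filterS FA => x Ax; exists x.
    exists ([set f (u x) | x in A], [set f (u x) | x in A]) => //.
    move=> [_ _] [/= [x Ax <-] [y Ay <-]].
    rewrite /ball /= -ltcR -fB; exact: le_lt_trans (fle _) (Ae _ _ Ax Ay).
  move=> /(@R_complete R _ (fmap_proper_filter _ FF)) /cvg_ex[l fl].
  exists l => e e0.
  have {}fl : F (fun x : T => ball l e (f (u x))) := fl (ball l e) (nbhsx_ballx _ _ e0).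
  by apply: filterS fl => x; rewrite /ball /= distrC.
have [a aP] := cv _ normc_Re_le (fun z w => raddfB (@complex.Re R : Rcomplex R -> R) z w).
have [b bP] := cv _ normc_Im_le (fun z w => raddfB (@complex.Im R : Rcomplex R -> R) z w).
exists (Complex a b) => e e0; have e20 : 0 < e / 2 by rewrite divr_gt0.
apply: filterS2 (aP _ e20) (bP _ e20) => n /= ha hb.
apply: le_lt_trans (normc_le_ReIm _) _; rewrite ltcR [ltRHS]splitr.
by case: (u n) ha hb => x y /= ha hb; rewrite ltrD.
Qed.

(** Coordinates are Cauchy, with limits [l s]. In each finite partial sum of [|x - y|^2] the limit
    in [y] can be taken, with a bound independent of the stage; this shows that [x - l] is
    square-summable, hence so is [l], and that the convergence is in norm. *)
Lemma l2_complete (F : set_system (l2 R E)) : ProperFilter F -> cauchy F -> cvg F.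
Proof.
move=> FF /cauchy_ballP Fc.
have {}Fc (e : R) : 0 < e -> exists2 A, F A &
    forall x y : l2 R E, A x -> A y -> `|x - y| < e%:C.
  move=> e0; have e20 : 0 < (e / 2)%:C :> C by rewrite ltcR divr_gt0.
  have [[A B] [/= FA FB] AB] := Fc _ e20.
  exists (A `&` B) => [|x y [Ax Bx] [Ay By]]; first exact: filterI.
  have {}AB z w : A z -> B w -> `|z - w| < (e / 2)%:C.
    by move=> Az Bw; have := AB (z, w) (conj Az Bw); rewrite -ball_normE.
  rewrite -(subrKA y); apply: le_lt_trans (ler_normD _ _) _.
  by rewrite [e]splitr rmorphD ltrD ?AB// subrr normr0.
have /choice[l lP] s : exists l : C, fcvg F (fun x : l2 R E => x s) l.
  apply: cauchy_fcvg => e /Fc[A FA Ae]; exists A => // x y Ax Ay.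
  exact: le_lt_trans (norm_le_l2 (x - y) s) (Ae _ _ Ax Ay).
have close (e : R) : 0 < e -> exists2 A, F A & forall (x : l2 R E) n, A x ->
    pdot n (fun s => x s - l s) (fun s => x s - l s) <= e%:C ^+ 2.
  move=> /[dup] e0 /Fc[A FA Ae]; exists A => // x n Ax.
  apply: (fcvg_le F (u := fun y : l2 R E => pdot n (x - y) (x - y))
    (v := fun=> e%:C ^+ 2) _ _ (fcvg_cst F _)).
    apply: filterS FA => y Ay; apply: le_trans (pdot_le_dot n (x - y)) _.
    by rewrite -l2_normE lerXn2r ?nnegrE ?ler0c ?(ltW e0)// ltW// Ae.
  apply: fcvg_sum => s.
  have h : fcvg F (fun y : l2 R E => (x - y) s) (x s - l s).
    rewrite -[- l s]mulN1r.
    apply: (eq_fcvg _ (fcvgD F (fcvg_cst F (x s)) (fcvgZ F (-1) (lP s)))).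
    by move=> y; rewrite mulN1r.
  by apply: fcvgM => //; exact: fcvgJ.
have lL2 : l \in @l2_pred R E.
  have [A FA Ae] := close 1 ltr01; have [x Ax] := filter_ex FA.
  have xl : (fun s => x s - l s) \in @l2_pred R E.
    apply/l2_predP; exists 1 => n; have := Ae x n Ax.
    by rewrite expr1n.
  have -> : l = x - L2 xl by apply/funext => s; rewrite l2DE l2NE /= subKr.
  exact: l2P.
apply/cvg_ex; exists (L2 lL2); apply/cvgrPdist_le => _ /gt0_complexE[e e0 ->].
have [A FA Ae] := close e e0; apply: filterS FA => x Ax.
rewrite distrC; apply: l2_norm_le => [|n]; first by rewrite ler0c ltW.
exact: Ae.
Qed.

HB.instance Definition _ := Uniform_isComplete.Build (l2 R E) l2_complete.
HB.instance Definition _ := @CompleteNormedModule_isHilbert.Build R (l2 R E)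
  (@l2_dot R E) (fun x => esym (l2_normE x)).

Lemma hdot_l2_cvg x y : fcvg nat_ultra (fun n => pdot n x y) (hdot x y).
Proof. exact: l2_dot_cvg. Qed.

Fact l2_delta_subproof (s : E) : (fun s' => (s' == s)%:R) \in @l2_pred R E.
Proof.
apply/l2_predP; exists 1 => n; rewrite /pdot.
have [sn|sn] := boolP (s \in exh_seq E n).
  rewrite (bigD1_seq s) ?exh_uniq//= eqxx conjC1 mulr1 big1 ?addr0// => i /negbTE ->.
  by rewrite mul0r.
rewrite big_seq big1 ?ler01// => i; case: eqP => [->|]; rewrite ?(negbTE sn)//.
by rewrite mul0r.
Qed.
Definition l2_delta s : l2 R E := L2 (l2_delta_subproof s).

Lemma l2_deltaE s s' : l2_delta s s' = (s' == s)%:R. Proof. by []. Qed.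

Lemma hdot_delta x s : hdot x (l2_delta s) = x s.
Proof.
apply: l2_dotE; have [n0 sn0] := exh_cover s.
apply: (near_fcvg nat_ultra _ (fcvg_cst nat_ultra (x s))).
apply: nat_ultra_eventually; exists n0 => // n /= n0n.
rewrite /pdot (bigD1_seq s) ?exh_uniq ?(exh_mono n0n)//= eqxx conjC1 mulr1.
by rewrite big1 ?addr0// => i /negbTE ->; rewrite conjC0 mulr0.
Qed.

(** The squared norm of the remainder is at most [l2_dot x x - pdot n x x], which is below [e ^+ 2]
    for some [n]. *)
Lemma l2_trunc_cvg x (e : R) : 0 < e ->
  exists n, `|x - \sum_(s <- exh_seq E n) x s *: l2_delta s| < e%:C.
Proof.
move=> e0; have e20 : 0 < e ^+ 2 by rewrite exprn_gt0.
have [n nP] := filter_ex (l2_dot_cvg x x e20); exists n.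
set y := \sum_(s <- _) _.
have yE s : y s = if s \in exh_seq E n then x s else 0.
  rewrite l2_sumE (eq_bigr (fun t => x t * (s == t)%:R))//; case: ifPn => sn.
    rewrite (bigD1_seq s) ?exh_uniq//= eqxx mulr1 big1 ?addr0//.
    by move=> i /negbTE si; rewrite eq_sym si mulr0.
  rewrite big_seq big1// => i isn.
  by case: eqP isn => [<-|]; rewrite ?(negbTE sn) ?mulr0.
rewrite -(ltr_pXn2r (ltn0Sn 1)) ?nnegrE ?ler0c ?(ltW e0)// l2_normE.
apply: (@le_lt_trans _ _ (l2_dot x x - pdot n x x)); last first.
  have := nP; rewrite distrC ger0_norm ?subr_ge0 ?pdot_le_dot//.
  by rewrite rmorphXn.
(* At stage [maxn n m] the partial sum splits: coordinates of stage [n] vanish in [x - y], and the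
   others are those of [x]. *)
apply: dot_le_pdot => m; apply: (@le_trans _ _ (pdot (maxn n m) (x - y) (x - y))).
  by apply: pdot_mono; rewrite leq_maxr.
rewrite lerBrDr; apply: le_trans (pdot_le_dot (maxn n m) x).
rewrite /pdot !(sum_exh_sub _ (leq_maxl n m)) [in X in X + _]big_seq big1 ?add0r.
  rewrite addrC lerD2l; apply: ler_sum => s sn.
  by rewrite l2DE l2NE yE (negbTE sn) subr0.
by move=> s sn; rewrite l2DE l2NE yE sn subrr mul0r.
Qed.

End L2Complete.

(** * Operators on square-summable families *)

Section LocalOperators.
Context {R : realType}.
Local Notation C := R[i].

(* The bound is required for each finite subset of the exhaustion, so that it
   survives tensoring with an identity operator. *)
Definition local_contr (E : exhaustion) (L : (E -> C) -> (E -> C)) :=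
  (forall a x y s, L (fun s => a * x s + y s) s = a * L x s + L y s) /\
  (forall n x, pdot n (L x) (L x) <= pdot n x x).

Definition local_pos (E : exhaustion) (L : (E -> C) -> (E -> C)) :=
  forall n x, 0 <= pdot n (L x) x.

Section Lift.
Context {E : exhaustion} {L : (E -> C) -> (E -> C)} (HL : local_contr L).

Lemma local0 s : L (fun=> 0) s = 0.
Proof.
have := HL.1 1 (fun=> 0) (fun=> 0) s; rewrite mulr0 addr0 mul1r => /eqP.
by rewrite addrC -subr_eq subrr eq_sym => /eqP.
Qed.

Lemma localZ a x s : L (fun s => a * x s) s = a * L x s.
Proof.
have := HL.1 a x (fun=> 0) s; rewrite local0 addr0 => <-.
by congr (L _ s); apply/funext => s'; rewrite addr0.
Qed.

Fact l2_lift_subproof1 (x : l2 R E) : L x \in @l2_pred R E.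
Proof.
have /l2_predP[M xM] := l2P x; apply/l2_predP; exists M => n.
exact: le_trans (HL.2 n x) (xM n).
Qed.

Let lift (x : l2 R E) : l2 R E := L2 (l2_lift_subproof1 x).

Fact l2_lift_subproof2 : lift \in @bounded_op R (l2 R E).
Proof.
apply/bounded_opP; split=> [a x y|]; first by apply: l2_eq => s; exact: HL.1.
exists 1 => x; rewrite mul1r; apply: l2_norm_le => // n.
by rewrite l2_normE (le_trans (HL.2 n x))// pdot_le_dot.
Qed.

Definition l2_lift : 'B(l2 R E) := BOp l2_lift_subproof2.

Lemma l2_liftE x s : l2_lift x s = L x s. Proof. by []. Qed.

Lemma l2_lift_pos : local_pos L -> positive_op l2_lift.
Proof.
move=> Lpos x; apply: (fcvg_ge0 nat_ultra _ (hdot_l2_cvg _ x)).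
by apply: filterE => n; exact: Lpos.
Qed.

End Lift.

Lemma bop_sumE (H : hilbertType R) (T : Type) (r : seq T) (P : pred T)
    (F : T -> 'B(H)) x : (\sum_(t <- r | P t) F t) x = \sum_(t <- r | P t) F t x.
Proof. by elim/big_rec2: _ => // t a y _ <-. Qed.

(** * Tensor products of spaces of square-summable families *)

Section Product.
Context (E1 E2 : exhaustion).

Fact prod_exh_uniq n : uniq [seq (a, b) | a <- exh_seq E1 n, b <- exh_seq E2 n].
Proof. by apply: allpairs_uniq; rewrite ?exh_uniq// => -[a b] [c d]. Qed.

Fact prod_exh_mono m n : (m <= n)%N ->
  {subset [seq (a, b) | a <- exh_seq E1 m, b <- exh_seq E2 m]
       <= [seq (a, b) | a <- exh_seq E1 n, b <- exh_seq E2 n]}.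
Proof.
move=> mn _ /allpairsP[[a b] /= [am bm ->]].
by apply: allpairs_f; exact: exh_mono mn _ _.
Qed.

Fact prod_exh_cover s : exists n,
  s \in [seq (a, b) | a <- exh_seq E1 n, b <- exh_seq E2 n].
Proof.
case: s => a b; have [m am] := exh_cover a; have [n bn] := exh_cover b.
exists (maxn m n); apply: allpairs_f.
  exact: exh_mono (leq_maxl m n) _ am.
exact: exh_mono (leq_maxr m n) _ bn.
Qed.

Definition prod_exh : exhaustion := @Exhaustion (E1 * E2)%type _
  prod_exh_uniq prod_exh_mono prod_exh_cover.

Implicit Types (z w : prod_exh -> C).

Lemma pdot_prod1 n z w : pdot n z w =
  \sum_(b <- exh_seq E2 n) pdot n (fun a => z (a, b)) (fun a => w (a, b)).
Proof. by rewrite /pdot big_allpairs exchange_big. Qed.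

Lemma pdot_prod2 n z w : pdot n z w =
  \sum_(a <- exh_seq E1 n) pdot n (fun b => z (a, b)) (fun b => w (a, b)).
Proof. by rewrite /pdot big_allpairs. Qed.

(** The operator [L] tensored with the identity: it acts on each slice with a fixed second
    coordinate. Finite partial sums decompose into slices, so contractivity and positivity are
    inherited. *)
Definition ampl1 (L : (E1 -> C) -> (E1 -> C)) z : prod_exh -> C :=
  fun p => L (fun a => z (a, p.2)) p.1.

Definition ampl2 (L : (E2 -> C) -> (E2 -> C)) z : prod_exh -> C :=
  fun p => L (fun b => z (p.1, b)) p.2.

Lemma ampl1_contr L : local_contr L -> local_contr (ampl1 L).
Proof.
move=> HL; split=> [a x y s|n x]; first exact: HL.1.
by rewrite !pdot_prod1; apply: ler_sum => b _; exact: (HL.2 n (fun a => x (a, b))).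
Qed.

Lemma ampl2_contr L : local_contr L -> local_contr (ampl2 L).
Proof.
move=> HL; split=> [a x y s|n x]; first exact: HL.1.
by rewrite !pdot_prod2; apply: ler_sum => a _; exact: (HL.2 n (fun b => x (a, b))).
Qed.

Lemma ampl1_pos L : local_pos L -> local_pos (ampl1 L).
Proof.
move=> HL n x; rewrite pdot_prod1 sumr_ge0// => b _.
exact: (HL n (fun a => x (a, b))).
Qed.

Lemma ampl2_pos L : local_pos L -> local_pos (ampl2 L).
Proof.
move=> HL n x; rewrite pdot_prod2 sumr_ge0// => a _.
exact: (HL n (fun b => x (a, b))).
Qed.

Lemma pdot_tens n (x x' : E1 -> C) (y y' : E2 -> C) :
  pdot (E := prod_exh) n (fun p => x p.1 * y p.2) (fun p => x' p.1 * y' p.2) =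
  pdot n x x' * pdot n y y'.
Proof.
rewrite pdot_prod2 /pdot mulr_suml; apply: eq_bigr => a _.
rewrite mulr_sumr; apply: eq_bigr => b _ /=.
by rewrite rmorphM mulrACA.
Qed.

Fact l2_tens_subproof (x : l2 R E1) (y : l2 R E2) :
  (fun p => x p.1 * y p.2) \in @l2_pred R prod_exh.
Proof.
have /l2_predP[M xM] := l2P x; have /l2_predP[N yN] := l2P y.
apply/l2_predP; exists (M * N) => n; rewrite pdot_tens rmorphM.
by rewrite ler_pM ?pdot_ge0.
Qed.

Definition l2_tens x y : l2 R prod_exh := L2 (l2_tens_subproof x y).

Lemma l2_tensE x y p : l2_tens x y p = x p.1 * y p.2. Proof. by []. Qed.

Lemma l2_tens_bilinear : bilinear_for
  (GRing.Scale.Law.clone _ _ *:%R _) (GRing.Scale.Law.clone _ _ *:%R _) l2_tens.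
Proof.
split=> [y a x x'|x a y y']; apply: l2_eq => p.
  change ((a * x p.1 + x' p.1) * y p.2 = a * (x p.1 * y p.2) + x' p.1 * y p.2).
  by rewrite mulrDl mulrA.
change (x p.1 * (a * y p.2 + y' p.2) = a * (x p.1 * y p.2) + x p.1 * y' p.2).
by rewrite mulrDr mulrCA.
Qed.

HB.instance Definition _ := @bilinear_isBilinear.Build C (l2 R E1) (l2 R E2)
  (l2 R prod_exh) _ _ l2_tens l2_tens_bilinear.

Lemma hdot_l2_tens x y x' y' :
  hdot (l2_tens x y) (l2_tens x' y') = hdot x x' * hdot y y'.
Proof.
apply: l2_dotE.
apply: (eq_fcvg _ (fcvgM nat_ultra (hdot_l2_cvg x x') (hdot_l2_cvg y y'))) => n.
by rewrite -pdot_tens.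
Qed.

Lemma l2_delta_tens a b :
  l2_delta (R := R) (E := prod_exh) (a, b) = l2_tens (l2_delta a) (l2_delta b).
Proof.
apply: l2_eq => -[c d]; rewrite l2_tensE !l2_deltaE /= xpair_eqE.
by case: (c == a); case: (d == b); rewrite ?(mulr0, mul0r, mulr1).
Qed.

(** Density: the truncations of [z] are finite combinations of point masses, and a point mass at a
    pair is an elementary tensor. *)
Lemma l2_hilbert_tensor : hilbert_tensor (l2_tens : {bilinear _ -> _ -> _}).
Proof.
split; first by move=> x x' y y'; exact: hdot_l2_tens.
apply/seteqP; split=> // z _ U /nbhs_ballP[_ /= /gt0_complexE[e e0 ->] zU].
have [n zn] := l2_trunc_cvg z e0; set w := \sum_(s <- _) _ in zn.
exists w; split; last by apply: zU; rewrite -ball_normE.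
pose S := exh_seq prod_exh n.
(* [p0] is only the default element for [nth]; an empty stage gives the empty sum. *)
have [[p0 _]|] := pselect (exists p : prod_exh, p \in S); last first.
  move=> nS; exists 0%N, (fun=> 0), (fun=> 0); rewrite big_ord0 /w big_seq big1// => p pS.
  by case: nS; exists p.
exists (size S), (fun k => z (nth p0 S k) *: l2_delta (nth p0 S k).1),
  (fun k => l2_delta (nth p0 S k).2).
rewrite /w (big_nth p0) big_mkord; apply: eq_bigr => k _.
rewrite linearZl_LR /= -l2_delta_tens.
by case: (nth p0 S k).
Qed.

(** The tensor product of two operators is built as the product of two amplifications, which are
    already known to be bounded. *)
Lemma l2_tensor_op L1 L2 (H1 : local_contr L1) (H2 : local_contr L2) :
  tensor_op (l2_tens : {bilinear _ -> _ -> _}) (l2_lift H1) (l2_lift H2)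
    (l2_lift (ampl1_contr H1) * l2_lift (ampl2_contr H2)).
Proof.
move=> x y; apply: l2_eq => p.
rewrite bopME l2_tensE !l2_liftE /ampl1 /ampl2 /=.
rewrite [RHS]mulrC -(localZ H1 (L2 y p.2) x p.1).
congr (L1 _ _); apply/funext => a.
by rewrite (localZ H2) mulrC.
Qed.

(** Both orders act in the same way on elementary tensors, which determine the operator. *)
Lemma l2_tensor_op_comm L1 L2 (H1 : local_contr L1) (H2 : local_contr L2) :
  l2_lift (ampl1_contr H1) * l2_lift (ampl2_contr H2) =
  l2_lift (ampl2_contr H2) * l2_lift (ampl1_contr H1).
Proof.
apply: (tensor_op_unique l2_hilbert_tensor (l2_tensor_op H1 H2)) => x y.
apply: l2_eq => p; rewrite bopME l2_tensE !l2_liftE /ampl1 /ampl2 /=.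
rewrite -(localZ H2); congr (L2 _ _); apply/funext => b.
rewrite mulrC -(localZ H1); congr (L1 _ _); apply/funext => a.
by rewrite mulrC.
Qed.

End Product.

(** * Direct sums of matrix blocks *)

Section Blocks.
Context (d : nat -> nat).
Local Notation Tg := (Tagged (fun n => 'I_(d n))).

Let bseq n : seq {n : nat & 'I_(d n)} := [seq Tg i | k <- iota 0 n, i <- enum 'I_(d k)].

Fact mem_bseq n s : (s \in bseq n) = (tag s < n)%N.
Proof.
apply/allpairsPdep/idP => [[k [i [kn _ ->]]]|sn]; first by rewrite mem_iota in kn.
by case: s sn => k i /= kn; exists k, i; rewrite mem_iota mem_enum.
Qed.

Fact bseq_uniq n : uniq (bseq n).
Proof.
apply: allpairs_uniq_dep => [|k _|]; rewrite ?iota_uniq ?enum_uniq//.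
by move=> [k i] [l j] _ _ /=; exact.
Qed.

Fact bseq_mono m n : (m <= n)%N -> {subset bseq m <= bseq n}.
Proof. by move=> mn s; rewrite !mem_bseq => /leq_trans; exact. Qed.

Fact bseq_cover s : exists n, s \in bseq n.
Proof. by exists (tag s).+1; rewrite mem_bseq. Qed.

(** The disjoint union of the index sets of the blocks; its [l2] is the Hilbert direct sum of the
    spaces C^(d n). Each stage consists of whole blocks, so block-diagonal operators act within a
    stage and satisfy the local bounds. *)
Definition block_exh : exhaustion :=
  @Exhaustion {n : nat & 'I_(d n)} _ bseq_uniq bseq_mono bseq_cover.

Lemma mem_block_exh n (s : block_exh) : (s \in exh_seq block_exh n) = (tag s < n)%N.
Proof. exact: mem_bseq. Qed.

Definition block_fun (M : forall n, 'M[C]_(d n)) (x : block_exh -> C) : block_exh -> C :=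
  fun s => \sum_i x (Tg i) * M (tag s) i (tagged s).

Definition block_row (x : block_exh -> C) n : 'rV_(d n) := \row_i x (Tg i).

Lemma pdot_block n (x y : block_exh -> C) : pdot (E := block_exh) n x y =
  \sum_(k <- iota 0 n) \sum_(i < d k) x (Tg i) * (y (Tg i))^*%R.
Proof.
by rewrite /pdot big_allpairs_dep; apply: eq_bigr => k _; rewrite big_enum.
Qed.

Lemma block_row_fun M x n : block_row (block_fun M x) n = block_row x n *m M n.
Proof. by apply/rowP => j; rewrite !mxE; apply: eq_bigr => i _; rewrite mxE. Qed.

Lemma pdot_block1 n x : pdot (E := block_exh) n x x =
  \sum_(k <- iota 0 n) mform 1%:M (block_row x k).
Proof.
rewrite pdot_block; apply: eq_bigr => k _; rewrite mform1.
by apply: eq_bigr => i _; rewrite mxE.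
Qed.

Lemma block_fun_contr M : (forall n, psdmx (M n)) -> (forall n, psdmx (1%:M - M n)) ->
  local_contr (block_fun M).
Proof.
move=> M0 M1; split=> [a x y s|n x].
  rewrite /block_fun mulr_sumr -big_split; apply: eq_bigr => i _ /=.
  by rewrite mulrDl mulrA.
rewrite !pdot_block1; apply: ler_sum => k _; rewrite block_row_fun.
exact: psdmx_contr.
Qed.

Lemma block_fun_pos M : (forall n, psdmx (M n)) -> local_pos (block_fun M).
Proof.
move=> M0 n x; rewrite pdot_block sumr_ge0// => k _.
suff -> : \sum_(i < d k) block_fun M x (Tg i) * (x (Tg i))^*%R = mform (M k) (block_row x k).
  exact: M0.
rewrite /mform -block_row_fun mxE; apply: eq_bigr => i _.
by rewrite !mxE.
Qed.

Lemma block_fun_delta M n (i j : 'I_(d n)) :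
  block_fun M (fun s => (s == Tg i)%:R) (Tg j) = M n i j.
Proof.
rewrite /block_fun /= (bigD1 i)//= eqxx mul1r big1 ?addr0// => k ki.
by rewrite eq_Tagged /= (negbTE ki) mul0r.
Qed.

End Blocks.

End LocalOperators.

(** * Vector states and matrix models *)

Section VectorStates.
Context {R : realType} {H : hilbertType R}.
Local Notation C := R[i].
Implicit Types (T : 'B(H)) (v : H) (s : seq H).

Lemma hdotDl (x y z : H) : hdot (x + y) z = hdot x z + hdot y z.
Proof. by rewrite linearDl. Qed.

Lemma hdotZl a (x z : H) : hdot (a *: x) z = a * hdot x z.
Proof. by rewrite linearZl_LR. Qed.

Lemma hdotDr (x y z : H) : hdot z (x + y) = hdot z x + hdot z y.
Proof. by rewrite linearDr. Qed.

Lemma hdotZr a (x z : H) : hdot z (a *: x) = a^*%R * hdot z x.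
Proof. by rewrite linearZr_LR. Qed.

Lemma hdot0l (z : H) : hdot 0 z = 0.
Proof. by rewrite linear0l. Qed.

Lemma hdot0r (z : H) : hdot z 0 = 0.
Proof. by rewrite linear0r. Qed.

Lemma hdot_suml (I : Type) (r : seq I) (P : pred I) (F : I -> H) z :
  hdot (\sum_(i <- r | P i) F i) z = \sum_(i <- r | P i) hdot (F i) z.
Proof. exact: (big_morph _ (fun x y => hdotDl x y z) (hdot0l z)). Qed.

Lemma hdot_sumr (I : Type) (r : seq I) (P : pred I) (F : I -> H) z :
  hdot z (\sum_(i <- r | P i) F i) = \sum_(i <- r | P i) hdot z (F i).
Proof. exact: (big_morph _ (fun x y => hdotDr x y z) (hdot0r z)). Qed.

Lemma norm_hdot_le (x y : H) : `|hdot x y| <= `|x| * `|y|.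
Proof.
rewrite -(ler_pXn2r (ltn0Sn 1)) ?nnegrE ?mulr_ge0// exprMn -!hdotxx.
exact: dot_cauchy_schwarz.
Qed.

(** A finite sum of vector functionals: a normal state of finite rank once the squared norms add up
    to 1. *)
Definition vform T s : C := \sum_(v <- s) hdot (T v) v.

Lemma vform1 s : vform 1 s = \sum_(v <- s) `|v| ^+ 2.
Proof. by apply: eq_bigr => v _; rewrite hdotxx. Qed.

Lemma vform_linear s : scalar (vform^~ s).
Proof.
move=> a S T; rewrite /vform mulr_sumr -big_split; apply: eq_bigr => v _ /=.
change (hdot (a *: S v + T v) v = a * hdot (S v) v + hdot (T v) v).
by rewrite hdotDl hdotZl.
Qed.

Lemma vform_bounded T : exists2 M : R, 0 <= M &
  forall s, `|vform T s| <= M%:C * vform 1 s.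
Proof.
have [M M0 TM] := bounded_op_ge0 (bop_bounded T); exists M => // s.
rewrite vform1 mulr_sumr; apply: le_trans (ler_norm_sum _ _ _) _.
apply: ler_sum => v _; apply: le_trans (norm_hdot_le _ _) _.
by rewrite expr2 mulrA ler_wpM2r.
Qed.

(** At each [T] the values are bounded, so the ultrafilter limit exists for all operators at once;
    linearity, positivity and the value at 1 pass to the limit. A constant sequence gives back the
    vector functional itself. *)
Lemma vform_state_lim (s : nat -> seq H) : (forall n, vform 1 (s n) = 1) ->
  exists2 w : {scalar 'B(H)}, is_state w &
  forall T l, fcvg nat_ultra (fun n => vform T (s n)) l -> w T = l.
Proof.
move=> s1; pose f T := ulim (fun n => vform T (s n)).
have cvgf T : fcvg nat_ultra (fun n => vform T (s n)) (f T).
  have [M _ TM] := vform_bounded T; apply: (@ulimP _ _ M) => n.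
  by apply: le_trans (TM _) _; rewrite s1 mulr1.
have flin : scalar f.
  move=> a S T; apply: ulimE.
  apply: (eq_fcvg _ (fcvgD nat_ultra (fcvgZ nat_ultra a (cvgf S)) (cvgf T))) => n.
  by rewrite vform_linear.
pose w : {scalar 'B(H)} := HB.pack f (GRing.isLinear.Build _ _ _ _ f flin).
exists w => [|T l Tl]; last exact: ulimE.
split=> [|T T0].
  by apply: ulimE; apply: (eq_fcvg _ (fcvg_cst nat_ultra 1)) => n; rewrite s1.
apply: (fcvg_ge0 nat_ultra _ (cvgf T)); apply: filterE => n.
by apply: sumr_ge0 => v _; exact: T0.
Qed.

End VectorStates.

Section TensorVectors.
Context {R : realType} {HA HB K : hilbertType R} (t : {bilinear HA -> HB -> K}).
Hypothesis ht : hilbert_tensor t.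
Context {m n : nat} (u : 'I_m -> HA) (v : 'I_n -> HB).
Implicit Types (z : 'rV[R[i]]_(m * n)).

Definition tensor_vec z : K := \sum_k
  z 0 k *: t (u (mxtens_unindex k).1) (v (mxtens_unindex k).2).

(** The passage from operators to matrices: the form of a tensor product operator, restricted to the
    span of the [t (u i) (v j)], is that of the Kronecker product of the two matrices of
    coefficients. *)
Lemma hdot_tensor_vec X Y T (M : 'M_m) (N : 'M_n) z : tensor_op t X Y T ->
  (forall i k, hdot (X (u i)) (u k) = M i k) ->
  (forall j l, hdot (Y (v j)) (v l) = N j l) ->
  hdot (T (tensor_vec z)) (tensor_vec z) = mform (M *t N) z.
Proof.
move=> hT hM hN; have -> : T (tensor_vec z) =
    \sum_k z 0 k *: t (X (u (mxtens_unindex k).1)) (Y (v (mxtens_unindex k).2)).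
  by rewrite linear_sum; apply: eq_bigr => k _; rewrite linearZ /= hT.
rewrite hdot_suml mformE; apply: eq_bigr => k _.
rewrite hdot_sumr; apply: eq_bigr => l _.
rewrite hdotZl hdotZr ht.1 hM hN mxE.
by rewrite -mulrA; congr (_ * _); rewrite mulrC.
Qed.

Lemma tensor_op1 : tensor_op t 1 1 1. Proof. by []. Qed.

Lemma hdot_tensor_vec1 z : (forall i k, hdot (u i) (u k) = (i == k)%:R) ->
  (forall j l, hdot (v j) (v l) = (j == l)%:R) ->
  hdot (tensor_vec z) (tensor_vec z) = mform 1%:M z.
Proof.
move=> hu hv; have -> : 1%:M = (1%:M : 'M[R[i]]_m) *t (1%:M : 'M_n).
  apply/matrixP => k l; rewrite !mxE -natrM mulnb -xpair_eqE -!surjective_pairing.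
  by rewrite (can_eq (@mxtens_unindexK m n)).
rewrite -(hdot_tensor_vec _ tensor_op1)// => i k; rewrite mxE.
  exact: hu.
exact: hv.
Qed.

End TensorVectors.

Section MatrixModels.
Context {R : realType}.
Local Notation C := R[i].

Definition matrix_povm {K : finType} {D : K -> finType} {n : nat}
    (M : forall k, D k -> 'M[C]_n) :=
  (forall k a, psdmx (M k a)) /\ (forall k, \sum_(a : D k) M k a = 1%:M).

Section OneSide.
Context {K : finType} {D : K -> finType}.

(** The complement of one element is the sum of the other elements. *)
Lemma matrix_povm_compl n (M : forall k, D k -> 'M[C]_n) k a :
  matrix_povm M -> psdmx (1%:M - M k a).
Proof.
move=> [M0 M1] x; rewrite -(M1 k) (bigD1 a)//= [X in X - _]addrC addrK mform_sum.
by rewrite sumr_ge0// => b _; exact: M0.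
Qed.

Context {d : nat -> nat} (M : forall n k, D k -> 'M[C]_(d n)).
Hypothesis MP : forall n, matrix_povm (M n).

Let Mfun k (a : D k) := block_fun (fun n => M n a).

Fact block_povm_contr k (a : D k) : local_contr (Mfun a).
Proof.
by apply: block_fun_contr => n; [exact: (MP n).1|exact: matrix_povm_compl].
Qed.

Let Mpos k (a : D k) : local_pos (Mfun a).
Proof. by apply: block_fun_pos => n; exact: (MP n).1. Qed.

Let Mfun_sum k x s : \sum_(a : D k) Mfun a x s = x s.
Proof.
case: s => n j; rewrite exchange_big /=.
transitivity (\sum_i x (Tagged (fun n => 'I_(d n)) i) *
    (1%:M : 'M[C]_(d n)) i j).
  by apply: eq_bigr => i _; rewrite -((MP n).2 k) summxE mulr_sumr.
rewrite (bigD1 j)//= mxE eqxx mulr1 big1 ?addr0// => i /negbTE ij.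
by rewrite mxE ij mulr0.
Qed.

Definition block_povm k (a : D k) : 'B(l2 R (block_exh d)) :=
  l2_lift (block_povm_contr a).

Lemma block_povmP : povm_family block_povm.
Proof.
split=> [k a|k]; first exact/l2_lift_pos/Mpos.
apply: bopP => x; apply: l2_eq => s; rewrite bop_sumE l2_sumE.
exact: Mfun_sum.
Qed.

Lemma block_povm_ampl1 (E : exhaustion) :
  povm_family (fun k (a : D k) => l2_lift (ampl1_contr E (block_povm_contr a))).
Proof.
split=> [k a|k]; first exact/l2_lift_pos/ampl1_pos/Mpos.
apply: bopP => x; apply: l2_eq => -[s s']; rewrite bop_sumE l2_sumE.
exact: (Mfun_sum _ (fun r => x (r, s'))).
Qed.

Lemma block_povm_ampl2 (E : exhaustion) :
  povm_family (fun k (a : D k) => l2_lift (ampl2_contr E (block_povm_contr a))).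
Proof.
split=> [k a|k]; first exact/l2_lift_pos/ampl2_pos/Mpos.
apply: bopP => x; apply: l2_eq => -[s' s]; rewrite bop_sumE l2_sumE.
exact: (Mfun_sum _ (fun r => x (s', r))).
Qed.

Definition block_delta n (i : 'I_(d n)) : l2 R (block_exh d) :=
  l2_delta (Tagged (fun n => 'I_(d n)) i : block_exh d).

Lemma hdot_block_povm n k (a : D k) (i j : 'I_(d n)) :
  hdot (block_povm a (block_delta i)) (block_delta j) = M n a i j.
Proof. by rewrite hdot_delta; exact: block_fun_delta. Qed.

Lemma hdot_block_delta n (i j : 'I_(d n)) :
  hdot (block_delta i) (block_delta j) = (i == j)%:R.
Proof. by rewrite hdot_delta l2_deltaE eq_Tagged /= eq_sym. Qed.

End OneSide.

Lemma l2_finite_dimensional (E : exhaustion) n : (forall s, s \in exh_seq E n) ->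
  finite_dimensional (l2 R E).
Proof.
move=> sE; exists (size (exh_seq E n)), (fun k => l2_delta (tnth (in_tuple (exh_seq E n)) k)).
move=> x; exists (fun k => x (tnth (in_tuple (exh_seq E n)) k)).
rewrite -(big_tnth _ _ _ xpredT (fun s => x s *: l2_delta s)).
apply: l2_eq => s; rewrite l2_sumE (eq_bigr (fun t => x t * (s == t)%:R))//.
rewrite (bigD1_seq s) ?exh_uniq//= eqxx mulr1 big1 ?addr0// => i /negbTE si.
by rewrite eq_sym si mulr0.
Qed.

Context {I J : finType} {A : I -> finType} {B : J -> finType}.

(** The list [tm_z] represents a mixed state; lists make the values attained at fixed operators a
    convex set. *)
Record tensor_model := TensorModel {
  tm_dA : nat; tm_dB : nat;
  tm_X : forall i, A i -> 'M[C]_tm_dA;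
  tm_Y : forall j, B j -> 'M[C]_tm_dB;
  tm_z : seq 'rV[C]_(tm_dA * tm_dB);
  tm_XP : matrix_povm tm_X;
  tm_YP : matrix_povm tm_Y;
  tm_z1 : \sum_(z <- tm_z) mform 1%:M z = 1 }.

Definition tm_corr (S : tensor_model) i j (a : A i) (b : B j) : C :=
  \sum_(z <- tm_z S) mform (tm_X S a *t tm_Y S b) z.

Definition tensor_approximable (p : forall i j, A i -> B j -> C) :=
  forall e : R, 0 < e -> exists S, forall i j (a : A i) (b : B j),
    `|p i j a b - tm_corr S a b| < e%:C.

Section Blocks.
Context (S : nat -> tensor_model).
Local Notation dA := (fun n => tm_dA (S n)).
Local Notation dB := (fun n => tm_dB (S n)).
Local Notation EA := (block_exh dA).
Local Notation EB := (block_exh dB).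
Local Notation X := (@block_povm _ _ dA (fun n => @tm_X (S n)) (fun n => tm_XP (S n))).
Local Notation Y := (@block_povm _ _ dB (fun n => @tm_Y (S n)) (fun n => tm_YP (S n))).

(** Places a vector of the [n]-th model in the tensor product of the two [n]-th blocks, where the
    block operators restrict to the matrices of that model. *)
Definition block_vec n (z : 'rV[C]_(tm_dA (S n) * tm_dB (S n))) :
    l2 R (prod_exh EA EB) :=
  tensor_vec (@l2_tens R EA EB) (@block_delta dA n) (@block_delta dB n) z.

Lemma vform_block1 n : vform 1 [seq block_vec z | z <- tm_z (S n)] = 1.
Proof.
rewrite /vform big_map -(tm_z1 (S n)); apply: eq_bigr => z _.
by apply: hdot_tensor_vec1 => [|i j|i j]; first exact: l2_hilbert_tensor;
  exact: hdot_block_delta.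
Qed.

Lemma vform_block n i j (a : A i) (b : B j) T :
  tensor_op (@l2_tens R EA EB) (X a) (Y b) T ->
  vform T [seq block_vec z | z <- tm_z (S n)] = tm_corr (S n) a b.
Proof.
move=> hT; rewrite /vform big_map; apply: eq_bigr => z _.
rewrite /block_vec.
by apply: (hdot_tensor_vec _ _ hT) => [|k l|k l]; first exact: l2_hilbert_tensor;
  exact: hdot_block_povm.
Qed.

End Blocks.

(** The direct sums of all models for the precisions 1/(n+1) carry one fixed pair of POVMs. The
    states of the single blocks have correlations tending to [p], so their ultrafilter limit
    reproduces [p] exactly. *)
Lemma tensor_approximable_tensor p : tensor_approximable p ->
  exists (HA HB HAB : hilbertType R) (t : {bilinear HA -> HB -> HAB})
         (X' : forall i : I, A i -> 'B(HA)) (Y' : forall j : J, B j -> 'B(HB))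
         (w' : {scalar 'B(HAB)}),
    [/\ hilbert_tensor t, povm_family X', povm_family Y', is_state w' &
        forall i j (a : A i) (b : B j),
          exists2 T : 'B(HAB), tensor_op t (X' i a) (Y' j b) T & p i j a b = w' T].
Proof.
move=> pT; have /choice[S Sp] (n : nat) : exists S, forall i j (a : A i) (b : B j),
    `|p i j a b - tm_corr S a b| < (n.+1%:R^-1)%:C.
  by apply: pT; rewrite invr_gt0.
have [w' w's w'E] := vform_state_lim (vform_block1 S).
exists (l2 R (block_exh (fun n => tm_dA (S n)))), (l2 R (block_exh (fun n => tm_dB (S n)))).
exists (l2 R (prod_exh (block_exh (fun n => tm_dA (S n))) (block_exh (fun n => tm_dB (S n))))).
exists (@l2_tens R _ _), (block_povm (fun n => tm_XP (S n))),
  (block_povm (fun n => tm_YP (S n))), w'.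
split=> //; [exact: l2_hilbert_tensor|exact: block_povmP|exact: block_povmP|].
move=> i j a b.
have hT := l2_tensor_op (block_povm_contr (fun n => tm_XP (S n)) a)
  (block_povm_contr (fun n => tm_YP (S n)) b).
eexists; first exact: hT.
apply/esym/w'E => e e0.
apply: nat_ultra_eventually; near=> n.
rewrite (@vform_block S n i j a b _ hT) distrC; apply: lt_trans (Sp n i j a b) _.
rewrite ltcR; near: n; exact: (near_infty_natSinv_lt (PosNum e0)).
Unshelve. all: by end_near. Qed.

Lemma tensor_approximable_finite p : (forall i j (a : A i) (b : B j), 0 <= p i j a b <= 1) ->
  tensor_approximable p -> approx_finite_dimensional p.
Proof.
move=> p01 pT; split=> // e /pT[S0 SP].
(* A single model is placed in block 0; all other blocks have size 0, so the direct sum is finite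
   dimensional. *)
pose d m k := if k is 0%N then m else 0%N.
pose ext m (M : 'M[C]_m) k : 'M[C]_(d m k) := if k is 0%N then M else 0.
have povm_ext (K : finType) (D : K -> finType) m (M : forall k, D k -> 'M[C]_m) n :
    matrix_povm M -> matrix_povm (fun k (a : D k) => ext m (M k a) n).
  move=> [M0 M1]; case: n => [|n]; first by split.
  (* At size 0 the zero matrix is also the identity. *)
  by split=> [k a x|k]; [rewrite mform0|rewrite flatmx0 [RHS]flatmx0].
pose EA := block_exh (d (tm_dA S0)); pose EB := block_exh (d (tm_dB S0)).
pose cX i (a : A i) := block_povm_contr (fun n => povm_ext _ _ _ _ n (tm_XP S0)) a.
pose cY j (b : B j) := block_povm_contr (fun n => povm_ext _ _ _ _ n (tm_YP S0)) b.
pose bv z := tensor_vec (@l2_tens R EA EB) (@block_delta (d (tm_dA S0)) 0%N)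
  (@block_delta (d (tm_dB S0)) 0%N) z.
have s1 (n : nat) : vform 1 [seq bv z | z <- tm_z S0] = 1.
  rewrite /vform big_map -(tm_z1 S0); apply: eq_bigr => z _.
  by apply: hdot_tensor_vec1 => [|i j|i j]; first exact: l2_hilbert_tensor;
  exact: hdot_block_delta.
have [w ws wE] := vform_state_lim s1.
exists (l2 R (prod_exh EA EB)), (fun i a => l2_lift (ampl1_contr EB (cX i a))),
  (fun j b => l2_lift (ampl2_contr EA (cY j b))), w.
split=> //.
(* Stage 1 contains exactly block 0 of each factor, hence every index. *)
- apply: (@l2_finite_dimensional _ 1%N) => -[[[|k] i] [[|l] j]]; try by [case: i|case: j].
  by apply: allpairs_f; rewrite mem_block_exh.
- split; [exact: block_povm_ampl1|exact: block_povm_ampl2].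
- by move=> i j a b; exact: l2_tensor_op_comm.
move=> i j a b; rewrite (wE _ (tm_corr S0 a b)); first exact: SP.
apply: (eq_fcvg _ (fcvg_cst nat_ultra _)) => n; apply/esym.
rewrite /vform big_map; apply: eq_bigr => z _.
rewrite /bv.
apply: (hdot_tensor_vec _ _ (l2_tensor_op (cX i a) (cY j b))) => [|k l|k l].
- exact: l2_hilbert_tensor.
- exact: (hdot_block_povm (fun n => povm_ext _ _ _ _ n (tm_XP S0)) a k l).
- exact: (hdot_block_povm (fun n => povm_ext _ _ _ _ n (tm_YP S0)) b k l).
Qed.

End MatrixModels.

(** * Approximation by vector states *)

Section ConvexCombinations.
Context {R : realType} {Q : finType} {V : eqType}.
Context (N : V -> R) (f : V -> Q -> R) (scale : R -> V -> V) (P : V -> Prop).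
Hypothesis N0 : forall v, 0 <= N v.
Hypothesis NZ : forall r v, N (scale r v) = r ^+ 2 * N v.
Hypothesis fZ : forall r v k, f (scale r v) k = r ^+ 2 * f v k.
Hypothesis PZ : forall r v, P v -> P (scale r v).
Hypothesis fN : exists M : R, forall v k, `|f v k| <= M * N v.

(** [N] and [f] are quadratic in the vector, so concatenating lists scaled by [sqrt (1 - t)] and
    [sqrt t] gives convex combinations of their values. Convex separation therefore applies to lists
    with total [N] equal to 1, and the test reduces to single vectors satisfying [P]. *)
Lemma approx_by_combinations (p : Q -> R) :
  (forall c (s : R), (forall v, P v -> 0 <= \sum_k c k * f v k + s * N v) ->
     0 <= \sum_k c k * p k + s) ->
  forall e : R, 0 < e -> exists2 s : seq V, (forall v, v \in s -> P v) &
    \sum_(v <- s) N v = 1 /\ forall k, `|\sum_(v <- s) f v k - p k| < e.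
Proof.
move=> sep; have [M fM] := fN.
pose D (x : Q -> R) := exists2 s : seq V, (forall v, v \in s -> P v) &
  \sum_(v <- s) N v = 1 /\ forall k, x k = \sum_(v <- s) f v k.
suff h : forall e : R, 0 < e -> exists2 x, D x & forall k, `|x k - p k| < e.
  move=> e /h[x [s sP [s1 xs]] xp]; exists s => //; split=> // k.
  by rewrite -xs.
apply: (@convex_separation _ _ p D M).
- move=> x y t [s sP [s1 xs]] [s' s'P [s'1 ys]] /andP[t0 t1].
  exists ([seq scale (Num.sqrt (1 - t)) v | v <- s] ++
          [seq scale (Num.sqrt t) v | v <- s']).
    by move=> v; rewrite mem_cat => /orP[] /mapP[u us ->]; apply: PZ; [exact: sP|exact: s'P].
  have t10 : 0 <= 1 - t by rewrite subr_ge0.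
  split=> [|k].
    rewrite big_cat !big_map /=; under eq_bigr do rewrite NZ.
    under [X in _ + X]eq_bigr do rewrite NZ.
    by rewrite -!mulr_sumr s1 s'1 !mulr1 !sqr_sqrtr// subrK.
  rewrite big_cat !big_map /=; under eq_bigr do rewrite fZ.
  under [X in _ = _ + X]eq_bigr do rewrite fZ.
  by rewrite -!mulr_sumr !sqr_sqrtr// xs ys.
- move=> x k [s sP [s1 xs]]; rewrite xs; apply: le_trans (ler_norm_sum _ _ _) _.
  rewrite -[leRHS]mulr1 -s1 mulr_sumr; apply: ler_sum => v _; exact: fM.
move=> c s cs; apply: sep => v Pv.
(* Where [N v] vanishes, the bound forces all [f v k] to vanish; otherwise [v] is rescaled to a
   one-element list with [N] equal to 1. *)
have [Nv0|Nv0] := eqVneq (N v) 0.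
  rewrite Nv0 mulr0 addr0 big1// => k _.
  have := fM v k; rewrite Nv0 mulr0 normr_le0 => /eqP ->.
  by rewrite mulr0.
have Nv : 0 < N v by rewrite lt_neqAle eq_sym Nv0 N0.
pose r := (Num.sqrt (N v))^-1.
have r2 : r ^+ 2 = (N v)^-1 by rewrite exprVn sqr_sqrtr.
have /cs : D (fun k => (N v)^-1 * f v k).
  exists [:: scale r v] => [u|]; first by rewrite inE => /eqP ->; exact: PZ.
  split=> [|k]; rewrite big_seq1 ?NZ ?fZ r2//.
  by rewrite mulVf.
rewrite -(pmulr_rge0 _ Nv) mulrDr mulr_sumr [N v * s]mulrC.
congr (0 <= _ + _); apply: eq_bigr => k _.
by rewrite mulrCA mulVKf.
Qed.

End ConvexCombinations.

(** * Orthonormal families and compression of operators to matrices *)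

Section OrthonormalFamilies.
Context {R : realType} {H : hilbertType R}.
Local Notation C := R[i].

Definition orthonormal_family d (u : 'I_d -> H) :=
  forall i k, hdot (u i) (u k) = (i == k)%:R.

(** For orthonormal [u] this Fourier expansion is membership in the linear span. *)
Definition in_span d (u : 'I_d -> H) x := x = \sum_i hdot x (u i) *: u i.

Lemma hdotC (x y : H) : hdot x y = (hdot y x)^*%R.
Proof. exact: dotC. Qed.

Lemma in_spanDZ d (u : 'I_d -> H) a x y :
  in_span u x -> in_span u y -> in_span u (a *: x + y).
Proof.
move=> xu yu; rewrite /in_span [in LHS]xu [in LHS]yu scaler_sumr -big_split.
by apply: eq_bigr => i _; rewrite hdotDl hdotZl scalerDl scalerA.
Qed.

Lemma in_span_sum d (u : 'I_d -> H) n (c : 'I_n -> C) (x : 'I_n -> H) :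
  (forall k, in_span u (x k)) -> in_span u (\sum_k c k *: x k).
Proof.
move=> xu; elim/big_ind: _ => [|y z yu zu|k _].
- by rewrite /in_span big1// => i _; rewrite hdot0l scale0r.
- by rewrite -[y]scale1r; exact: in_spanDZ.
rewrite -[_ *: _]addr0; apply: in_spanDZ => //.
by rewrite /in_span big1// => i _; rewrite hdot0l scale0r.
Qed.

(** Induction on the list: the residual [y] of the new vector is discarded if zero, and otherwise
    normalized and put in front of the family. *)
Lemma gram_schmidt (s : seq H) : exists d (u : 'I_d -> H),
  orthonormal_family u /\ forall x, x \in s -> in_span u x.
Proof.
elim: s => [|x s [d [u [uo us]]]].
  by exists 0%N, (fun=> 0); split=> // -[].
pose y := x - \sum_i hdot x (u i) *: u i.
have [y0|y0] := eqVneq y 0.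
  exists d, u; split=> // z; rewrite inE => /orP[/eqP ->|/us//].
  exact: subr0_eq y0.
have yu i : hdot y (u i) = 0.
  rewrite /y -scaleN1r hdotDl hdotZl hdot_suml (bigD1 i)//= hdotZl uo eqxx mulr1.
  by rewrite big1 ?addr0 ?mulN1r ?subrr// => k /negbTE ki; rewrite hdotZl uo ki mulr0.
have ny0 : `|y| != 0 by rewrite normr_eq0.
pose u0 := `|y|^-1 *: y.
have nyJ : (`|y|^-1)^*%R = `|y|^-1 by rewrite (CrealP _)// realV normr_real.
have u0u i : hdot u0 (u i) = 0 by rewrite hdotZl yu mulr0.
have uu0 i : hdot (u i) u0 = 0 by rewrite hdotC u0u conjC0.
have u00 : hdot u0 u0 = 1.
  by rewrite hdotZl hdotZr hdotxx nyJ expr2 mulKf// mulVf.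
pose u' (i : 'I_d.+1) := oapp u u0 (unlift ord0 i).
have u'0 : u' ord0 = u0 by rewrite /u' unlift_none.
have u'l i : u' (lift ord0 i) = u i by rewrite /u' liftK.
exists d.+1, u'; split.
  move=> i k; case: (unliftP ord0 i) => [i' ->|->]; case: (unliftP ord0 k) => [k' ->|->].
  - by rewrite !u'l uo (inj_eq lift_inj).
  - by rewrite u'l u'0 uu0 eq_sym (negbTE (neq_lift _ _)).
  - by rewrite u'l u'0 u0u (negbTE (neq_lift _ _)).
  - by rewrite u'0 u00 eqxx.
move=> z; rewrite inE /in_span big_ord_recl u'0 => zs.
under eq_bigr do rewrite u'l.
case/orP: zs => [/eqP ->|/us zu]; last first.
  have -> : hdot z u0 = 0.
    by rewrite zu hdot_suml big1// => i _; rewrite hdotZl uu0 mulr0.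
  by rewrite scale0r add0r.
have xE : x = y + \sum_i hdot x (u i) *: u i by rewrite subrK.
have -> : hdot x u0 = `|y|.
  rewrite xE hdotDl hdot_suml big1 ?addr0 => [|i _].
    by rewrite hdotZr hdotxx nyJ expr2 mulKf.
  by rewrite hdotZl uu0 mulr0.
by rewrite scalerA divff// scale1r.
Qed.

Context {d : nat} (u : 'I_d -> H).

(* Row convention: the product of operators becomes the reversed product of
   matrices, see [op_matrixM]. *)
Definition op_matrix (T : 'B(H)) : 'M[C]_d := \matrix_(k, l) hdot (T (u k)) (u l).

Lemma op_matrix_form T (z : 'rV_d) :
  mform (op_matrix T) z = hdot (T (\sum_k z 0 k *: u k)) (\sum_k z 0 k *: u k).
Proof.
have -> : T (\sum_k z 0 k *: u k) = \sum_k z 0 k *: T (u k).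
  by rewrite linear_sum; apply: eq_bigr => k _; rewrite linearZ.
rewrite hdot_suml mformE; apply: eq_bigr => k _.
rewrite hdot_sumr; apply: eq_bigr => l _.
by rewrite hdotZl hdotZr !mxE -mulrA; congr (_ * _); rewrite mulrC.
Qed.

Lemma op_matrix_psd T : positive_op T -> psdmx (op_matrix T).
Proof. by move=> T0 z; rewrite op_matrix_form. Qed.

Lemma op_matrixDZ a S T : op_matrix (a *: S + T) = a *: op_matrix S + op_matrix T.
Proof.
apply/matrixP => k l; rewrite !mxE.
change (hdot (a *: S (u k) + T (u k)) (u l) =
  a * hdot (S (u k)) (u l) + hdot (T (u k)) (u l)).
by rewrite hdotDl hdotZl.
Qed.

Lemma op_matrix0 : op_matrix 0 = 0.
Proof. by have := op_matrixDZ (-1) 0 0; rewrite !scaleN1r !addNr. Qed.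

Lemma op_matrixD S T : op_matrix (S + T) = op_matrix S + op_matrix T.
Proof. by have := op_matrixDZ 1 S T; rewrite !scale1r. Qed.

Lemma op_matrixZ a S : op_matrix (a *: S) = a *: op_matrix S.
Proof. by have := op_matrixDZ a S 0; rewrite !addr0 op_matrix0 addr0. Qed.

Lemma op_matrix_sum (I : Type) (r : seq I) (P : pred I) (T : I -> 'B(H)) :
  op_matrix (\sum_(i <- r | P i) T i) = \sum_(i <- r | P i) op_matrix (T i).
Proof. exact: (big_morph _ op_matrixD op_matrix0). Qed.

Hypothesis uo : orthonormal_family u.

Lemma op_matrix1 : op_matrix 1 = 1%:M.
Proof. by apply/matrixP => k l; rewrite !mxE; exact: uo. Qed.

(** Compression to the span of an orthonormal family preserves positivity and sends 1 to the
    identity matrix. *)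
Lemma op_matrix_povm (K : finType) (D : K -> finType) (X : forall k, D k -> 'B(H)) :
  povm_family X -> matrix_povm (fun k a => op_matrix (X k a)).
Proof.
move=> [X0 X1]; split=> [k a|k]; first exact/op_matrix_psd/X0.
by rewrite -op_matrix_sum X1 op_matrix1.
Qed.

Hypothesis uspan : forall x, in_span u x.

Lemma op_matrixM S T : op_matrix (S * T) = op_matrix T *m op_matrix S.
Proof.
apply/matrixP => k l; rewrite !mxE bopME [T (u k)]uspan linear_sum hdot_suml.
by apply: eq_bigr => i _; rewrite linearZ hdotZl !mxE.
Qed.

Lemma psd_op_matrix T : psdmx (op_matrix T) -> positive_op T.
Proof.
move=> T0 x; have := T0 (\row_i hdot x (u i)); rewrite op_matrix_form.
by under eq_bigr do rewrite mxE; rewrite -uspan.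
Qed.

End OrthonormalFamilies.

(** * From commuting operators in finite dimension to matrix models *)

Section FiniteDimensionalToTensor.
Local Open Scope sesquilinear_scope.
Context {R : realType} {I J : finType} {A : I -> finType} {B : J -> finType}.
Local Notation C := R[i].

Definition corr_index : finType := ({i : I & A i} * {j : J & B j})%type.

Lemma RealE (z : C) : z \is Num.real -> z = (complex.Re z)%:C.
Proof. by move=> zr; rewrite RRe_real. Qed.

Lemma normc_realC (r : R) : `|r%:C : C| = `|r|%:C.
Proof. by rewrite normc_def /= expr0n addr0 sqrtr_sqr. Qed.

Lemma ReD (x y : C) : complex.Re (x + y) = complex.Re x + complex.Re y.
Proof. by case: x y => a b [c d]. Qed.

Lemma ReZ (r : R) (x : C) : complex.Re (r%:C * x) = r * complex.Re x.
Proof. by case: x => a b /=; rewrite mul0r subr0. Qed.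

Lemma Re_sum (T : Type) (s : seq T) (P : pred T) (F : T -> C) :
  complex.Re (\sum_(t <- s | P t) F t) = \sum_(t <- s | P t) complex.Re (F t).
Proof. exact: (big_morph _ ReD erefl). Qed.

Lemma Re_ge0 (x : C) : 0 <= x -> 0 <= complex.Re x.
Proof. by case: x => a b; rewrite lecE /= => /andP[]. Qed.

Lemma conj_realC (r : R) : (r%:C)^*%R = r%:C :> C.
Proof. exact: conjc_real. Qed.

Lemma mform_scale n (M : 'M[C]_n) (r : R) x : mform M (r%:C *: x) = (r ^+ 2)%:C * mform M x.
Proof.
rewrite !mformE mulr_sumr; apply: eq_bigr => i _.
rewrite mulr_sumr; apply: eq_bigr => j _; rewrite !mxE rmorphM /= rmorphXn.
rewrite conj_realC.
ring.
Qed.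

Lemma herm_scale_real n (r : R) (M : 'M[C]_n) :
  M ^t* = M -> (r%:C *: M) ^t* = r%:C *: M.
Proof.
move=> Mh; apply/matrixP => i j.
by rewrite -[in RHS]Mh !mxE rmorphM /= conj_realC.
Qed.

Lemma psdmx_tens_le1 m n (M : 'M[C]_m) (N : 'M[C]_n) z : psdmx M -> psdmx N ->
  psdmx (1%:M - M) -> psdmx (1%:M - N) -> mform (M *t N) z <= mform 1%:M z.
Proof.
move=> M0 N0 M1 N1; rewrite -subr_ge0 -mulN1r -mformZ -mformD scaleN1r.
(* The difference is a sum of two Kronecker products of positive semidefinite matrices. *)
have -> : 1%:M - M *t N = (1%:M - M) *t 1%:M + M *t (1%:M - N).
  apply/matrixP => k l; case: (mxtens_indexP k) => k1 k2; case: (mxtens_indexP l) => l1 l2.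
  rewrite !mxE !mxtens_indexK /= (can_eq (@mxtens_indexK m n)) xpair_eqE /=.
  rewrite mulrBl mulrBr addrA subrK.
  by rewrite -natrM mulnb.
by rewrite mformD; apply: addr_ge0; apply: psdmx_tens; [|exact: psdmx1| |].
Qed.

Lemma finite_dimensional_basis (H : hilbertType R) : finite_dimensional H ->
  exists d (u : 'I_d -> H), orthonormal_family u /\ forall x, in_span u x.
Proof.
move=> [n [e eH]]; have [d [u [uo ue]]] := gram_schmidt (codom e).
exists d, u; split=> // x; have [c ->] := eH x; apply: in_span_sum => k.
by apply: ue; exact: codom_f.
Qed.

(** In an orthonormal basis the commuting POVMs become matrix POVMs. Half of [e] pays for the
    finite-dimensional model, half for approximating its state by vector functionals at the
    Kronecker products. *)
Lemma approx_finite_dimensional_tensor (p : forall i j, A i -> B j -> C) :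
  approx_finite_dimensional p -> tensor_approximable p.
Proof.
move=> [p01 pF] e e0; have e20 : 0 < e / 2 by rewrite divr_gt0.
have [H [X [Y [w [Hfin [XP YP] XY [w1 w0] wp]]]]] := pF _ e20.
have [d [u [uo us]]] := finite_dimensional_basis Hfin.
pose MX i (a : A i) := op_matrix u (X i a).
pose MY j (b : B j) := op_matrix u (Y j b).
have MXP : matrix_povm MX by exact: op_matrix_povm.
have MYP : matrix_povm MY by exact: op_matrix_povm.
pose TX (k : corr_index) := MX _ (tagged k.1); pose TY (k : corr_index) := MY _ (tagged k.2).
pose pw (k : corr_index) := complex.Re (w (X _ (tagged k.1) * Y _ (tagged k.2))).
have TXY k l : TX k *m TY l = TY l *m TX k.
  by rewrite /TX /TY -!op_matrixM// XY.
have T0 k : psdmx (TX k *t TY k).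
  by apply: psdmx_tens; [exact: MXP.1|exact: MYP.1].
have Re_mform n (M : 'M[C]_n) z : psdmx M -> mform M z = (complex.Re (mform M z))%:C.
  by move=> M0; apply/RealE/ger0_real.
have [] := @approx_by_combinations R corr_index 'rV[C]_(d * d)
  (fun z => complex.Re (mform 1%:M z)) (fun z k => complex.Re (mform (TX k *t TY k) z))
  (fun r z => r%:C *: z) (fun=> True) _ _ _ _ _ pw _ (e / 2) e20.
- by move=> z; apply: Re_ge0; exact: psdmx1.
- by move=> r z; rewrite mform_scale ReZ.
- by move=> r z k; rewrite mform_scale ReZ.
- by [].
- exists 1 => z k; rewrite mul1r ger0_norm ?Re_ge0 ?T0//.
  rewrite -lecR -!Re_mform//; last exact: psdmx1.
  apply: psdmx_tens_le1; [exact: MXP.1|exact: MYP.1| |]; exact: matrix_povm_compl.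
(* An affine functional nonnegative on all vectors at the Kronecker products says that the
   combination of these is positive semidefinite. The same combination [S] of the products of
   commuting operators is then positive, so [w S] is nonnegative. *)
- move=> c s cs; pose S : 'B(H) :=
    \sum_(k : corr_index) (c k)%:C *: (X _ (tagged k.1) * Y _ (tagged k.2)) + s%:C *: (1 : 'B(H)).
  have SE : op_matrix u S = \sum_k (c k)%:C *: (TX k *m TY k) + s%:C *: 1%:M.
    rewrite op_matrixD op_matrix_sum op_matrixZ op_matrix1//.
    (* Compression reverses products; commutation restores the order. *)
    by congr (_ + _); apply: eq_bigr => k _; rewrite op_matrixZ (op_matrixM us) -TXY.
  have S0 : positive_op S.
    apply: (psd_op_matrix us); rewrite SE.
    apply: psdmx_mul_of_tens => //.
      rewrite linearD linear_sum !map_mxD !map_mx_sum /=.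
      congr (_ + _); last by apply: herm_scale_real; rewrite trmx1 map_mx1.
      apply: eq_bigr => k _; apply: herm_scale_real; rewrite trmx_mul map_mxM.
      by rewrite (psdmx_herm (MXP.1 _ _)) (psdmx_herm (MYP.1 _ _)) -TXY.
    move=> z; rewrite mformD mform_sum mformZ.
    have -> : \sum_k mform ((c k)%:C *: (TX k *t TY k)) z + s%:C * mform 1%:M z =
        (\sum_k c k * complex.Re (mform (TX k *t TY k) z) +
         s * complex.Re (mform 1%:M z))%:C.
      rewrite rmorphD rmorph_sum rmorphM /= -(Re_mform _ 1%:M); last exact: psdmx1.
      by congr (_ + _); apply: eq_bigr => k _; rewrite mformZ rmorphM /= -Re_mform.
    by rewrite ler0c; exact: cs.
  suff <- : complex.Re (w S) = \sum_k c k * pw k + s by exact: Re_ge0 (w0 S S0).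
  rewrite linearD linear_sum ReD Re_sum; congr (_ + _).
    by apply: eq_bigr => k _; rewrite linearZ; exact: ReZ.
  by rewrite linearZ w1 /= mulr1 mul0r subr0.
move=> zs _ [zs1 zsp].
have sumRe M : psdmx M ->
    \sum_(z <- zs) mform M z = (\sum_(z <- zs) complex.Re (mform M z))%:C :> C.
  by move=> M0; rewrite rmorph_sum; apply: eq_bigr => z _; exact: Re_mform.
have zs1' : \sum_(z <- zs) mform 1%:M z = 1 :> C.
  by rewrite sumRe ?zs1//; exact: psdmx1.
exists (TensorModel MXP MYP zs1') => i j a b.
pose k : corr_index := (Tagged A a, Tagged B b).
rewrite /tm_corr /= sumRe; last exact: (T0 k).
have pR : p i j a b \is Num.real by have /andP[/ger0_real] := p01 i j a b.
rewrite [p i j a b](RealE pR) -rmorphB normc_realC ltcR.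
rewrite -(subrKA (pw k)); apply: le_lt_trans (ler_normD _ _) _.
rewrite [ltRHS]splitr ltrD//; last by rewrite distrC; exact: (zsp k).
(* [p] is real, so its distance to [pw k] is a difference of real parts, bounded by the complex
   distance. *)
rewrite -ltcR; apply: le_lt_trans (wp i j a b).
have -> : complex.Re (p i j a b) - pw k =
    complex.Re (p i j a b - w (X i a * Y j b)).
  by rewrite /pw /=; case: (p i j a b) (w _) => x y [x' y'].
exact: normc_Re_le.
Qed.

End FiniteDimensionalToTensor.

(** * Tensor products of Hilbert spaces *)

Section TensorToFinite.
Context {R : realType}.
Local Notation C := R[i].

Section TensorSpan.
Context {HA HB K : hilbertType R} (t : {bilinear HA -> HB -> K}).
Hypothesis ht : hilbert_tensor t.

Definition finite_tensor (z : K) := exists n (x : 'I_n -> HA) (y : 'I_n -> HB),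
  z = \sum_(k < n) t (x k) (y k).

Lemma finite_tensorZ a z : finite_tensor z -> finite_tensor (a *: z).
Proof.
move=> [n [x [y ->]]]; exists n, (fun k => a *: x k), y.
by rewrite scaler_sumr; apply: eq_bigr => k _; rewrite linearZl_LR.
Qed.

Lemma finite_tensor_dense (z : K) (e : R) : 0 < e ->
  exists2 z', finite_tensor z' & `|z - z'| < e%:C.
Proof.
move=> e0; have : closure finite_tensor z by rewrite ht.2.
move=> /(_ (ball z e%:C)) []; first by apply: nbhsx_ballx; rewrite ltcR.
by move=> z' [z'F]; rewrite -ball_normE; exists z'.
Qed.

Lemma tensor_vecD m n (u : 'I_m -> HA) (v : 'I_n -> HB) z w :
  tensor_vec t u v (z + w) = tensor_vec t u v z + tensor_vec t u v w.
Proof. by rewrite -big_split; apply: eq_bigr => k _; rewrite mxE scalerDl. Qed.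

Lemma tensor_vec_span m n (u : 'I_m -> HA) (v : 'I_n -> HB) x y :
  in_span u x -> in_span v y -> exists z, t x y = tensor_vec t u v z.
Proof.
move=> xu yv; exists (\row_k (hdot x (u (mxtens_unindex k).1) *
  hdot y (v (mxtens_unindex k).2))).
rewrite /tensor_vec sum_mxtens [in LHS]xu [in LHS]yv linear_sumlz.
apply: eq_bigr => i _; rewrite linear_sumr; apply: eq_bigr => j _.
by rewrite linearZl_LR linearZ_LR mxE mxtens_indexK scalerA.
Qed.

(** Collect all left factors and all right factors that occur in the finitely many sums, and
    orthonormalize each of the two lists. *)
Lemma finite_tensor_common (s : seq K) : (forall z, z \in s -> finite_tensor z) ->
  exists m n (u : 'I_m -> HA) (v : 'I_n -> HB),
    [/\ orthonormal_family u, orthonormal_family v &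
        exists zs, s = map (tensor_vec t u v) zs].
Proof.
move=> sF; have [LA [LB sL]] : exists (LA : seq HA) (LB : seq HB), forall z, z \in s ->
    exists n (x : 'I_n -> HA) (y : 'I_n -> HB), [/\ z = \sum_(k < n) t (x k) (y k),
      forall k, x k \in LA & forall k, y k \in LB].
  elim: s sF => [|z s IH] sF; first by exists [::], [::].
  have [w ws|LA [LB LP]] := IH; first by apply: sF; rewrite inE ws orbT.
  have [n [x [y zE]]] := sF z (mem_head _ _).
  exists (codom x ++ LA), (codom y ++ LB) => w; rewrite inE => /orP[/eqP ->|/LP].
    by exists n, x, y; split=> // k; rewrite mem_cat codom_f.
  move=> [n' [x' [y' [wE xL yL]]]]; exists n', x', y'; split=> // k.
    by rewrite mem_cat xL orbT.
  by rewrite mem_cat yL orbT.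
have [m [u [uo us]]] := gram_schmidt LA; have [n [v [vo vs]]] := gram_schmidt LB.
exists m, n, u, v; split=> //.
have {}sL z : z \in s -> exists w, z = tensor_vec t u v w.
  move=> /sL[l [x [y [-> xL yL]]]].
  have /choice[w wE] k : exists w, t (x k) (y k) = tensor_vec t u v w.
    by apply: tensor_vec_span; [exact/us/xL|exact/vs/yL].
  exists (\sum_k w k); under eq_bigr do rewrite wE.
  apply: esym; apply: (big_morph _ (@tensor_vecD m n u v)).
  by rewrite /tensor_vec big1// => k _; rewrite mxE scale0r.
elim: s sL {sF} => [|z s IH] sL; first by exists [::].
have [w ws|zs zsE] := IH; first by apply: sL; rewrite inE ws orbT.
have [w zw] := sL z (mem_head _ _).
by exists (w :: zs); rewrite /= -zw -zsE.
Qed.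

Lemma finite_tensor_positive (T : 'B(K)) :
  (forall z, finite_tensor z -> 0 <= hdot (T z) z) -> positive_op T.
Proof.
move=> T0 z; have [M M0 TM] := bounded_op_ge0 (bop_bounded T).
have [r r0] := norm_complexE `|z|; rewrite normr_id => rz.
apply: near_ge0 => e e0.
(* Moving [z] by at most [e'] changes [<T z, z>] by at most [q e']; here [e' <= 1] keeps the norm of
   [z'] below [r + 1], and [q + 1] avoids a division by 0. *)
pose q := M * r + M * (r + 1).
have q0 : 0 <= q by rewrite addr_ge0// mulr_ge0// addr_ge0.
pose e' := Num.min 1 (e / (q + 1)).
have q10 : 0 < q + 1 by rewrite ltr_wpDl.
have e'0 : 0 < e' by rewrite lt_min ltr01 divr_gt0.
have [z' z'F zz'] := finite_tensor_dense z e'0.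
exists (hdot (T z') z'); first exact: T0.
have -> : hdot (T z') z' - hdot (T z) z =
    hdot (T (z' - z)) z + hdot (T z') (z' - z).
  rewrite linearB -[- z]scaleN1r -[- T z]scaleN1r hdotDl hdotDr hdotZl hdotZr.
  by rewrite mulN1r rmorphN rmorph1 mulN1r [RHS]addrC addrA subrK.
have z'r : `|z'| <= (r + 1)%:C.
  rewrite -(subrK z z') addrC; apply: le_trans (ler_normD _ _) _.
  rewrite rz rmorphD lerD2l distrC; apply: le_trans (ltW zz') _.
  by rewrite lecR ge_min lexx.
rewrite distrC in zz'.
apply: le_trans (ler_normD _ _) _.
apply: (@le_trans _ _ (q%:C * e'%:C)).
  rewrite rmorphD mulrDl; apply: lerD; apply: le_trans (norm_hdot_le _ _) _.
    rewrite rz rmorphM mulrAC ler_wpM2r ?ler0c//.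
    by apply: le_trans (TM _) _; rewrite ler_wpM2l ?ler0c// ltW.
  rewrite rmorphM ler_pM// ?(ltW zz')//.
  by apply: le_trans (TM _) _; rewrite ler_wpM2l ?ler0c.
rewrite -rmorphM lecR; apply: (@le_trans _ _ ((q + 1) * (e / (q + 1)))).
  rewrite ler_pM ?(ltW e'0)//; first by rewrite lerDl.
  by rewrite ge_min lexx orbT.
by rewrite mulrCA divff ?mulr1// gt_eqF.
Qed.

Lemma tensor_op_pos_finite X Y T z : positive_op X -> positive_op Y ->
  tensor_op t X Y T -> finite_tensor z -> 0 <= hdot (T z) z.
Proof.
move=> X0 Y0 hT zF; have [w|m [n [u [v [_ _ [zs zsE]]]]]] := @finite_tensor_common [:: z].
  by rewrite inE => /eqP ->.
have : z \in map (tensor_vec t u v) zs by rewrite -zsE mem_head.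
move=> /mapP[w _ ->]; rewrite (hdot_tensor_vec ht w hT (M := op_matrix u X)
  (N := op_matrix v Y)) => [|i k|i k]; try by rewrite mxE.
by apply: psdmx_tens; exact: op_matrix_psd.
Qed.

(** On algebraic tensors the form of [T] is that of a Kronecker product of compressions of [X] and
    [Y]; density extends positivity to the whole space. *)
Lemma tensor_op_positive X Y T : positive_op X -> positive_op Y ->
  tensor_op t X Y T -> positive_op T.
Proof.
move=> X0 Y0 hT; apply: finite_tensor_positive => z; exact: tensor_op_pos_finite hT.
Qed.

End TensorSpan.

(** * From tensor product models to matrix models *)

Context {I J : finType} {A : I -> finType} {B : J -> finType}.
Context {HA HB K : hilbertType R} {t : {bilinear HA -> HB -> K}}.
Hypothesis ht : hilbert_tensor t.
Context {X : forall i : I, A i -> 'B(HA)} {Y : forall j : J, B j -> 'B(HB)}.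
Hypotheses (XP : povm_family X) (YP : povm_family Y).
Context {w : {scalar 'B(K)}} (ws : is_state w).
Context {T : forall i j, A i -> B j -> 'B(K)}.
Hypothesis hT : forall i j (a : A i) (b : B j), tensor_op t (X a) (Y b) (T a b).

Let T0 i j (a : A i) (b : B j) : positive_op (T a b).
Proof. exact: tensor_op_positive (XP.1 _ _) (YP.1 _ _) (hT a b). Qed.

Lemma tensor_corr_ge0_le1 i j (a : A i) (b : B j) : 0 <= w (T a b) <= 1.
Proof.
have w0 a' b' : 0 <= w (T (i := i) (j := j) a' b') by exact/ws.2/T0.
rewrite w0 /= -ws.1.
(* The sum over all outcomes is the tensor product of 1 and 1, hence 1 by uniqueness; each single
   value is one nonnegative term of a sum equal to 1. *)
have <- : \sum_(a' : A i) \sum_(b' : B j) T a' b' = 1.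
  apply: (tensor_op_unique ht _ (tensor_op1 t)) => x y.
  have xE : x = \sum_(a' : A i) X a' x by rewrite -bop_sumE (XP.2 i).
  have yE : y = \sum_(b' : B j) Y b' y by rewrite -bop_sumE (YP.2 j).
  rewrite bop_sumE !bop1E [in RHS]xE linear_sumlz.
  apply: eq_bigr => a' _; rewrite bop_sumE [in RHS]yE linear_sumr.
  by apply: eq_bigr => b' _; exact: hT.
rewrite linear_sum (bigD1 a)//= linear_sum (bigD1 b)//= -addrA lerDl.
rewrite addr_ge0 ?sumr_ge0// => a' _.
by rewrite linear_sum sumr_ge0.
Qed.

Lemma tensor_tensor_approximable : tensor_approximable (fun i j (a : A i) (b : B j) => w (T a b)).
Proof.
move=> e e0; pose TT (k : corr_index (A := A) (B := B)) := T (tagged k.1) (tagged k.2).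
have [] := @approx_by_combinations R (corr_index (A := A) (B := B)) K
  (fun v => complex.Re (hdot v v)) (fun v k => complex.Re (hdot (TT k v) v))
  (fun r v => r%:C *: v) (finite_tensor t) _ _ _ _ _ (fun k => complex.Re (w (TT k))) _ e e0.
- by move=> v; apply: Re_ge0; exact: dot_ge0.
- by move=> r v; rewrite hdotZl hdotZr conj_realC !ReZ mulrA.
- by move=> r v k; rewrite [TT k _]linearZ hdotZl hdotZr conj_realC !ReZ mulrA.
- by move=> r v; exact: finite_tensorZ.
- have /choice[M TM] k : exists M : R, 0 <= M /\ forall v, `|TT k v| <= M%:C * `|v|.
    by have [M M0 TM] := bounded_op_ge0 (bop_bounded (TT k)); exists M.
  (* The sum of the operator bounds serves for all [k] at once. *)
  exists (\sum_k M k) => v k; have [r r0] := norm_complexE `|v|.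
  rewrite normr_id => rv.
  rewrite -lecR; apply: le_trans (normc_Re_le _) _.
  apply: le_trans (norm_hdot_le _ _) _.
  have -> : complex.Re (hdot v v) = r * r by rewrite hdotxx rv -rmorphXn /= expr2.
  rewrite mulrA; apply: (@le_trans _ _ ((M k * r)%:C * r%:C)).
    rewrite rv ler_wpM2r ?ler0c// (le_trans ((TM k).2 v))// rv.
    by rewrite -rmorphM.
  rewrite -rmorphM lecR !ler_wpM2r// (bigD1 k)//= lerDl.
  by rewrite sumr_ge0// => l _; exact: (TM l).1.
(* Nonnegativity on algebraic tensors makes [S] positive by density, and every state, normal or not,
   is nonnegative at [S]. *)
- move=> c s cs; pose S : 'B(K) := \sum_k (c k)%:C *: TT k + s%:C *: (1 : 'B(K)).
  have S0 : positive_op S.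
    apply: (finite_tensor_positive ht) => z zF.
    have -> : hdot (S z) z = (\sum_k c k * complex.Re (hdot (TT k z) z) +
        s * complex.Re (hdot z z))%:C.
      have -> : S z = \sum_k (c k)%:C *: TT k z + s%:C *: z.
        transitivity ((\sum_k (c k)%:C *: TT k) z + s%:C *: z) => //.
        by rewrite bop_sumE.
      rewrite hdotDl hdot_suml hdotZl rmorphD rmorph_sum rmorphM /=.
      rewrite -[in RHS](RealE (ger0_real (dot_ge0 (@hdot R K) z))).
      congr (_ + _); apply: eq_bigr => k _; rewrite hdotZl rmorphM /=.
      by rewrite -[in RHS]RealE// ger0_real// T0.
    by rewrite ler0c; exact: cs.
  suff <- : complex.Re (w S) = \sum_k c k * complex.Re (w (TT k)) + s.
    exact: Re_ge0 (ws.2 S S0).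
  rewrite linearD linear_sum ReD Re_sum; congr (_ + _).
    by apply: eq_bigr => k _; rewrite linearZ; exact: ReZ.
  by rewrite linearZ ws.1 /= mulr1 mul0r subr0.
(* The finitely many vectors found lie in one finite-dimensional tensor product; compressing both
   POVMs to its factors leaves the values unchanged. *)
move=> s /finite_tensor_common[m [n [u [v [uo vo [zs ->]]]]]] [].
rewrite big_map => s1 sT.
have zs1 : \sum_(z <- zs) mform 1%:M z = 1 :> C.
  rewrite -[RHS](congr1 (fun r => r%:C) s1) rmorph_sum; apply: eq_bigr => z _ /=.
  rewrite -RealE; last by apply: ger0_real; exact: dot_ge0.
  by rewrite (hdot_tensor_vec1 ht).
exists (TensorModel (op_matrix_povm uo XP) (op_matrix_povm vo YP) zs1) => i j a b.
pose k : corr_index (A := A) (B := B) := (Tagged A a, Tagged B b).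
have := sT k; rewrite big_map /tm_corr /= => sk.
rewrite (RealE (ger0_real (ws.2 _ (T0 a b)))).
have -> : \sum_(z <- zs) mform (op_matrix u (X a) *t op_matrix v (Y b)) z =
   (\sum_(z <- zs) complex.Re (hdot (T a b (tensor_vec t u v z)) (tensor_vec t u v z)))%:C.
  rewrite rmorph_sum; apply: eq_bigr => z _ /=.
  rewrite -RealE; last by apply/ger0_real/T0.
  by apply/esym/(hdot_tensor_vec ht z (hT a b)) => i' k'; rewrite mxE.
by rewrite -rmorphB normc_realC ltcR distrC.
Qed.

End TensorToFinite.

(** * Both implications, by way of matrix models *)

Theorem theorem3 (R : realType) (I J : finType)
    (A : I -> finType) (B : J -> finType) (H : hilbertType R)
    (X : forall i : I, A i -> 'B(H)) (Y : forall j : J, B j -> 'B(H))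
    (hX : povm_family X) (hY : povm_family Y)
    (hXY : forall i j (a : A i) (b : B j), X i a * Y j b = Y j b * X i a)
    (w : {scalar 'B(H)}) (hw : is_state w) :
  let p := correlation w X Y in
  approx_finite_dimensional p <->
  exists (HA HB HAB : hilbertType R) (t : {bilinear HA -> HB -> HAB})
         (X' : forall i : I, A i -> 'B(HA)) (Y' : forall j : J, B j -> 'B(HB))
         (w' : {scalar 'B(HAB)}),
    [/\ hilbert_tensor t,
        povm_family X',
        povm_family Y',
        is_state w' &
        forall i j (a : A i) (b : B j),
          exists2 T : 'B(HAB), tensor_op t (X' i a) (Y' j b) T &
                               p i j a b = w' T].
Proof.
move=> p; split=> [/approx_finite_dimensional_tensor/tensor_approximable_tensor//|].
move=> [HA [HB [HAB [t [X' [Y' [w' [ht X'P Y'P w's w'p]]]]]]]].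
(* The tensor product operators are given by separate existence statements; choice collects them
   into one family. *)
pose T i j (a : A i) (b : B j) : 'B(HAB) := sval (cid2 (w'p i j a b)).
have hT i j (a : A i) (b : B j) : tensor_op t (X' i a) (Y' j b) (T i j a b).
  by rewrite /T; case: cid2.
have -> : p = fun i j (a : A i) (b : B j) => w' (T i j a b).
  do 4 apply: functional_extensionality_dep => ?.
  by rewrite /T; case: cid2.
apply: tensor_approximable_finite => [i j a b|].
  exact: (tensor_corr_ge0_le1 ht X'P Y'P w's hT).
exact: (tensor_tensor_approximable ht X'P Y'P w's hT).
Qed.
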